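(* Consider the jump-diffusion $(X,Y)$ with values in $\mathbb R^m\times\mathcal D$, the function $u(t,x,y)=\mathbb E[f(X_T^{t,x,y},Y_T^{t,y})]$, the Markov chains $(\hat Y^h_n)_{n=0,\dots,N}$ ($h=T/N$), the grid $\mathcal X$ with step $\Delta x$, the linear operators $\Pi^h_{\Delta x}(y)$, $y\in\mathcal D$, and the backward scheme $(u^h_n)_{n=0,\dots,N}$, all as in the context. Let $p\in[1,\infty]$, $c:\mathcal D\to[0,\infty)$, and $\mathcal E=\mathcal E(h,\Delta x)\ge0$ with $\lim_{(h,\Delta x)\to0}\mathcal E(h,\Delta x)=0$. Assume that the linear operators $\Pi^h_{\Delta x}(y):l_p(\mathcal X)\to l_p(\mathcal X)$, $y\in\mathcal D$, satisfy: (stability) $|\Pi^h_{\Delta x}(y)|_p\le 1+c(y)h$ for every $y\in\mathcal D$; (consistency) for every $n=0,\dots,N-1$, $$\mathbb E\big[\Pi^h_{\Delta x}(\hat Y^h_n)u((n+1)h,\cdot,\hat Y^h_{n+1})(x)\,\big|\,\hat Y^h_n\big]=u(nh,x,\hat Y^h_n)+\mathcal R^h_n(x,\hat Y^h_n),\quad x\in\mathcal X,$$ where the remainder is such that there exist $\bar h,C>0$ for which, for every $h<\bar h$, $\Delta x<1$ and $0\le n\le N-1$, $$\Big\|e^{\sum_{l=1}^n c(\hat Y^h_l)h}\,\big|\mathcal R^h_n(\cdot,\hat Y^h_n)\big|_p\Big\|_p\le C\,h\,\mathcal E(h,\Delta x).$$ Then there exist $\bar h,C>0$ (independent of $h$ and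 $\Delta x$) such that for every $h<\bar h$ and $\Delta x<1$ $$\big|u(0,\cdot,Y_0)-u^h_0(\cdot,Y_0)\big|_p\le C\,T\,\mathcal E(h,\Delta x).$$
   Context: Setting. $\mathcal D\subseteq\mathbb R^d$ is a convex domain or the closure of one; $T>0$; $f:\mathbb R^m\times\mathcal D\to\mathbb R$; $$dX_t=\mu_X(Y_t)dt+\sigma_X(Y_t)dB_t+\gamma_X(Y_t)dH_t,\ X_0\in\mathbb R^m,\qquad dY_t=\mu_Y(Y_t)dt+\sigma_Y(Y_t)dW_t,\ Y_0\in\mathcal D,$$ with $B$, $W$ independent Brownian motions of dimension $\ell_1$, $\ell$, and $H_t=\sum_{k=1}^{K_t}J_k$ an $\ell_2$-dimensional compound Poisson process with intensity $\lambda$ whose i.i.d. jumps have a density; the Poisson process $K$, the jumps $\{J_k\}$ and $(B,W)$ are independent; $\nu(dx)=\nu(x)dx=\lambda p_{J_1}(x)dx$ is the Lévy measure. $(X^{t,x,y},Y^{t,y})$ is the solution starting from $(x,y)$ at time $t$. Standing assumptions: (1) there is a unique weak solution and it lives in $\mathbb R^m\times\mathcal D$ a.s.; (2) $u$ solves $\partial_tu+\mathcal Lu=0$ on $[0,T)\times\mathbb R^m\times\mathcal D$, $u(T,\cdot)=f$, where $\mathcal Lg(x,y)=\frac12\mathrm{Tr}(\sigma_X\sigma_X^\star(y)D_x^2g)+\frac12\mathrm{Tr}(\sigma_Y\sigma_Y^\star(y)D_y^2g)+\mu_X(y)\cdot\nabla_xg+\mu_Y(y)\cdot\nabla_yg+\int(g(x+\gamma_X(y)\zeta,y)-g(x,y))\nu(d\zeta)$.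 Discretization. $h=T/N$, $N\in\mathbb N^*$. For each $h$, $(\hat Y^h_n)_{n=0,\dots,N}$ is a Markov chain with state space $\mathcal Y^h_n\subseteq\mathcal D$ at step $n$, $\hat Y^h_0=Y_0$, independent of $B$ and $H$. $\Delta x=(\Delta x_1,\dots,\Delta x_m)\in(0,\infty)^m$ ($\Delta x<1$ is meant componentwise), $\mathcal X=\{((X_0)_1+i_1\Delta x_1,\dots,(X_0)_m+i_m\Delta x_m): i\in\mathbb Z^m\}$. $l_p(\mathcal X)$ is the space of $\varphi:\mathcal X\to\mathbb R$ with finite norm $|\varphi|_p=(\sum_{x\in\mathcal X}|\varphi(x)|^p\Delta x_1\cdots\Delta x_m)^{1/p}$ for $p<\infty$, $|\varphi|_\infty=\sup_{\mathcal X}|\varphi|$; for linear $\Gamma:l_p(\mathcal X)\to l_p(\mathcal X)$, $|\Gamma|_p=\sup_{|\varphi|_p\le1}|\Gamma\varphi|_p$; for $g:\mathbb R^m\to\mathbb R$, $|g|_p$ is the $l_p(\mathcal X)$ norm of its restriction to $\mathcal X$. $\|\cdot\|_p$ is the norm of $L^p(\Omega)$. Scheme: $u^h_N(x,y)=f(x,y)$ for $(x,y)\in\mathcal X\times\mathcal Y^h_N$ and, for $n=N-1,\dots,0$, $u^h_n(x,y)=\mathbb E[\Pi^h_{\Delta x}(y)u^h_{n+1}(\cdot,\hat Y^h_{n+1})(x)\mid\hat Y^h_n=y]$ for $(x,y)\in\mathcal X\times\mathcal Y^h_n$. It is understood that $u(nh,\cdot,y)\in l_p(\mathcal X)$, so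 that all expressions above are well defined. *)

(* Defs.v *)
(* Vectors of R^n are columns ['cV[R]_n]. *)
From HB Require Import structures.
From mathcomp Require Import all_boot all_order all_algebra.
From mathcomp Require Import all_classical all_reals all_analysis.

Set Implicit Arguments.
Unset Strict Implicit.
Unset Printing Implicit Defensive.

Import Order.TTheory GRing.Theory Num.Theory.
Import numFieldTopology.Exports numFieldNormedType.Exports.

Local Open Scope classical_set_scope.
Local Open Scope ring_scope.

(* Borel sigma-algebra on spaces of matrices. *)
HB.instance Definition _ (R : realType) (m n : nat) :=
  Measurable.copy 'M[R]_(m, n) (g_sigma_algebraType (@open 'M[R]_(m, n))).

Definition sigma1 d d' (Om : measurableType d) (E : measurableType d')
    (Z : Om -> E) : set (set Om) :=
  preimage_set_system setT Z measurable.

Definition sigma_family d d' (Om : measurableType d) (E : measurableType d')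
    (I : Type) (D : set I) (Z : I -> Om -> E) : set (set Om) :=
  <<s \bigcup_(i in D) sigma1 (Z i) >>.

Definition independent2 (R : realType) d (Om : measurableType d)
    (P : probability Om R) (G1 G2 : set (set Om)) : Prop :=
  forall A1 A2, G1 A1 -> G2 A2 -> P (A1 `&` A2) = (P A1 * P A2)%E.

(* Each [G k] is meant to be a sigma-algebra; as it contains [setT], the initial
   segments below cover all finite subfamilies. *)
Definition mutually_independent (R : realType) d (Om : measurableType d)
    (P : probability Om R) (G : nat -> set (set Om)) : Prop :=
  forall (n : nat) (A : nat -> set Om),
    (forall k, (k < n)%N -> G k (A k)) ->
    P (\bigcap_(k in `I_n) A k) = (\prod_(k < n) fine (P (A k)))%:E.

Definition cvg0_in_probability (R : realType) d (Om : measurableType d)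
    (P : probability Om R) (Z : nat -> Om -> \bar R) : Prop :=
  forall eps : R, 0 < eps ->
    P [set w | (eps%:E <= `|Z k w|)%E] @[k --> \oo] --> 0%E.

(* [Z] is a version of E[V | G]. *)
Definition is_cond_exp (R : realType) d (Om : measurableType d)
    (P : probability Om R) (G : set (set Om)) (V Z : Om -> R) : Prop :=
  [/\ P.-integrable setT (EFin \o V),
      P.-integrable setT (EFin \o Z),
      sigma1 Z `<=` G &
      forall A, G A -> (\int[P]_(w in A) (V w)%:E = \int[P]_(w in A) (Z w)%:E)%E].

(* g(y) = E[Psi(Y, Y') | Y = y] for y in S, where Y and Y' take their values in
   S and S'; as usual [g] is determined up to a null set of the law of Y. *)
Definition is_cond_exp_at (R : realType) d d' (Om : measurableType d)
    (E : measurableType d') (P : probability Om R) (S S' : set E)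
    (Y Y' : Om -> E) (Psi : E -> E -> R) (g : E -> R) : Prop :=
  [/\ measurable_fun (S `*` S') (fun z => Psi z.1 z.2),
      measurable_fun S g &
      is_cond_exp P (sigma1 Y) (fun w => Psi (Y w) (Y' w)) (g \o Y)].

Definition markov_chain (R : realType) d d' (Om : measurableType d)
    (E : measurableType d') (P : probability Om R) (N : nat)
    (S : nat -> set E) (Y : nat -> Om -> E) : Prop :=
  [/\ forall n, (n <= N)%N -> measurable (S n),
      forall n, (n <= N)%N -> measurable_fun setT (Y n),
      forall n w, (n <= N)%N -> S n (Y n w) &
      forall n (A : set E), (n < N)%N -> measurable A ->
        exists g : E -> R, measurable_fun (S n) g /\
          is_cond_exp P (sigma_family [set k | (k <= n)%N] Y)
            (\1_(Y n.+1 @^-1` A)) (g \o Y n)].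

(* Integral over R^n with respect to Lebesgue measure, as an iterated integral;
   used for nonnegative Borel functions only (Tonelli). *)
Fixpoint lebesgue_int (R : realType) (n : nat) :
    ('cV[R]_n -> \bar R) -> \bar R :=
  match n return ('cV[R]_n -> \bar R) -> \bar R with
  | 0 => fun g => g 0
  | n'.+1 => fun g =>
      (\int[lebesgue_measure]_(t in [set: R])
         lebesgue_int (fun z : 'cV[R]_n' =>
           g (col_mx (t%:M : 'cV[R]_1) z : 'cV[R]_(1 + n'))))%E
  end.

Definition has_density (R : realType) (n : nat)
    (mu : probability 'cV[R]_n R) (p : 'cV[R]_n -> R) : Prop :=
  [/\ measurable_fun setT p, forall z, 0 <= p z &
      forall A : set 'cV[R]_n, measurable A ->
        mu A = lebesgue_int (fun z => (p z * \1_A z)%:E)].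

(* Data of dX = mu_X(Y)dt + sigma_X(Y)dB + gamma_X(Y)dH, dY = mu_Y(Y)dt +
   sigma_Y(Y)dW, where H is compound Poisson. *)
Record coefficients (R : realType) (m d l1 l l2 : nat) := Coefficients {
  mu_X : 'cV[R]_d -> 'cV[R]_m;
  sigma_X : 'cV[R]_d -> 'M[R]_(m, l1);
  gamma_X : 'cV[R]_d -> 'M[R]_(m, l2);
  mu_Y : 'cV[R]_d -> 'cV[R]_d;
  sigma_Y : 'cV[R]_d -> 'M[R]_(d, l);
  intensity : {posnum R};
  jump_law : probability 'cV[R]_l2 R }.

Definition levy_measure (R : realType) (m d l1 l l2 : nat)
    (co : coefficients R m d l1 l l2) : {measure set 'cV[R]_l2 -> \bar R} :=
  mscale ((intensity co)%:num)%:nng (jump_law co).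

(* A filtered probability space with processes indexed by time in [0, +oo[;
   values at negative times are irrelevant. J k is the (k+1)-st jump. *)
Record jump_system (R : realType) (m d l1 l l2 : nat) := JumpSystem {
  disp : measure_display;
  Omega : measurableType disp;
  Pr : probability Omega R;
  filt : R -> set (set Omega);
  BB : R -> Omega -> 'cV[R]_l1;
  WW : R -> Omega -> 'cV[R]_l;
  KK : R -> Omega -> nat;
  JJ : nat -> Omega -> 'cV[R]_l2;
  XX : R -> Omega -> 'cV[R]_m;
  YY : R -> Omega -> 'cV[R]_d }.

Arguments disp {R m d l1 l l2} S : rename.
Arguments Omega {R m d l1 l l2} S : rename.
Arguments Pr {R m d l1 l l2} S : rename.
Arguments filt {R m d l1 l l2} S : rename.
Arguments BB {R m d l1 l l2} S : rename.
Arguments WW {R m d l1 l l2} S : rename.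
Arguments KK {R m d l1 l l2} S : rename.
Arguments JJ {R m d l1 l l2} S : rename.
Arguments XX {R m d l1 l l2} S : rename.
Arguments YY {R m d l1 l l2} S : rename.

Definition HH (R : realType) (m d l1 l l2 : nat)
    (S : jump_system R m d l1 l l2) (t : R) (w : Omega S) : 'cV[R]_l2 :=
  \sum_(k < KK S t w) JJ S k w.
Arguments HH {R m d l1 l l2} S t w.

Definition nonneg_times (R : realType) : set R := [set s | 0 <= s].

Definition is_filtration (R : realType) d (Om : measurableType d)
    (F : R -> set (set Om)) : Prop :=
  [/\ forall s, 0 <= s -> sigma_algebra setT (F s),
      forall s, 0 <= s -> F s `<=` measurable &
      forall s r, 0 <= s <= r -> F s `<=` F r].

Definition adapted_on (R : realType) d d' (Om : measurableType d)
    (E : measurableType d') (F : R -> set (set Om)) (D : set R)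
    (Z : R -> Om -> E) : Prop :=
  forall s, D s -> sigma1 (Z s) `<=` F s.

Definition is_brownian (R : realType) d (Om : measurableType d)
    (P : probability Om R) (n : nat) (B : R -> Om -> 'cV[R]_n) : Prop :=
  [/\ forall s, 0 <= s -> measurable_fun setT (B s),
      forall w, B 0 w = 0,
      forall w, {within `[0, +oo[%classic, continuous (B ^~ w)},
      (* B_r - B_s has law N(0, (r - s) I_n) *)
      forall s r, 0 <= s < r -> forall A : 'I_n -> set R,
        (forall i, measurable (A i)) ->
        P [set w | forall i, A i ((B r w - B s w) i 0)] =
          (\prod_i fine (normal_prob 0 (Num.sqrt (r - s)) (A i)))%:E &
      forall s r, 0 <= s < r ->
        independent2 P (sigma_family `[0, s]%classic B)
          (sigma1 (fun w => B r w - B s w))].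

Definition is_poisson_process (R : realType) d (Om : measurableType d)
    (P : probability Om R) (lambda : R) (K : R -> Om -> nat) : Prop :=
  [/\ forall s, 0 <= s -> measurable_fun setT (K s),
      forall w, K 0 w = 0%N,
      forall w s, 0 <= s ->
        (forall r, s <= r -> (K s w <= K r w)%N) /\
        (\forall r \near s^'+, K r w = K s w),
      forall s r k, 0 <= s < r ->
        P [set w | (K r w - K s w)%N = k] =
          (poisson_pmf (lambda * (r - s)) k)%:E &
      forall s r, 0 <= s < r ->
        independent2 P (sigma_family `[0, s]%classic K)
          (sigma1 (fun w => (K r w - K s w)%N))].

(* sigma(B), sigma(W), sigma(K), sigma(J_1), sigma(J_2), ... *)
Definition noise_sources (R : realType) (m d l1 l l2 : nat)
    (S : jump_system R m d l1 l l2) (k : nat) : set (set (Omega S)) :=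
  match k with
  | 0 => sigma_family (@nonneg_times R) (BB S)
  | 1 => sigma_family (@nonneg_times R) (WW S)
  | 2 => sigma_family (@nonneg_times R) (KK S)
  | k'.+3 => sigma1 (JJ S k')
  end.
Arguments noise_sources {R m d l1 l l2} S k.

(* Requiring this sigma-algebra to be independent of [filt S s] makes B, W and H
   Brownian motions and a compound Poisson process relative to the filtration. *)
Definition future_noise (R : realType) (m d l1 l l2 : nat)
    (S : jump_system R m d l1 l l2) (s : R) : set (set (Omega S)) :=
  let later := [set r : R | s <= r] in
  <<s sigma_family later (fun r (w : Omega S) => BB S r w - BB S s w) `|`
      sigma_family later (fun r (w : Omega S) => WW S r w - WW S s w) `|`
      sigma_family later (fun r (w : Omega S) => (KK S r w - KK S s w)%N) `|`
      sigma_family later (fun r (w : Omega S) => HH S r w - HH S s w) >>.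
Arguments future_noise {R m d l1 l l2} S s.

Record driving_noise (R : realType) (m d l1 l l2 : nat)
    (co : coefficients R m d l1 l l2) (S : jump_system R m d l1 l l2) :
    Prop := DrivingNoise {
  dn_filtration : is_filtration (filt S);
  dn_B : is_brownian (Pr S) (BB S);
  dn_W : is_brownian (Pr S) (WW S);
  dn_K : is_poisson_process (Pr S) (intensity co)%:num (KK S);
  dn_J_measurable : forall k, measurable_fun setT (JJ S k);
  dn_J_law : forall k (A : set 'cV[R]_l2), measurable A ->
    Pr S (JJ S k @^-1` A) = jump_law co A;
  dn_independent : mutually_independent (Pr S) (noise_sources S);
  dn_B_adapted : adapted_on (filt S) (@nonneg_times R) (BB S);
  dn_W_adapted : adapted_on (filt S) (@nonneg_times R) (WW S);
  dn_K_adapted : adapted_on (filt S) (@nonneg_times R) (KK S);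
  dn_H_adapted : adapted_on (filt S) (@nonneg_times R) (HH S);
  dn_future : forall s, 0 <= s ->
    independent2 (Pr S) (filt S s) (future_noise S s) }.

(* The simple process sum_j xi_j 1_]t_j, t_(j+1)] and its integral up to s. *)
Record simple_process (R : realType) (Om : Type) := SimpleProcess {
  sp_size : nat;
  sp_time : nat -> R;
  sp_val : nat -> Om -> R }.

Definition simple_on (R : realType) d (Om : measurableType d)
    (F : R -> set (set Om)) (t T : R) (phi : simple_process R Om) : Prop :=
  forall j, (j < sp_size phi)%N ->
    [/\ t <= sp_time phi j <= sp_time phi j.+1, sp_time phi j.+1 <= T,
        exists M : R, forall w, `|sp_val phi j w| <= M &
        sigma1 (sp_val phi j) `<=` F (sp_time phi j)].

Definition simple_eval (R : realType) (Om : Type) (phi : simple_process R Om)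
    (r : R) (w : Om) : R :=
  \sum_(j < sp_size phi)
    sp_val phi j w * \1_(`]sp_time phi j, sp_time phi j.+1]%classic) r.

Definition simple_integral (R : realType) (Om : Type)
    (phi : simple_process R Om) (b : R -> Om -> R) (s : R) (w : Om) : R :=
  \sum_(j < sp_size phi) sp_val phi j w *
    (b (Num.min (sp_time phi j.+1) s) w - b (Num.min (sp_time phi j) s) w).

(* [I] is the Ito integral process s |-> int_t^s Phi_r db_r on [t, T]: the
   limit in probability of the integrals of simple processes converging to Phi
   in L^2([t, T]) in probability. *)
Definition is_ito_integral (R : realType) d (Om : measurableType d)
    (P : probability Om R) (F : R -> set (set Om)) (b : R -> Om -> R)
    (t T : R) (Phi I : R -> Om -> R) : Prop :=
  [/\ adapted_on F `[t, T]%classic Phi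
      /\ measurable_fun (`[t, T]%classic `*` [set: Om])
           (fun z => Phi z.1 z.2),
      {ae P, forall w, (\int[lebesgue_measure]_(r in `[t, T]%classic)
                          (Phi r w ^+ 2)%:E < +oo)%E},
      forall s, t <= s <= T -> measurable_fun setT (I s),
      {ae P, forall w, {within `[t, T]%classic, continuous (I ^~ w)}} &
      exists phi : nat -> simple_process R Om,
        [/\ forall k, simple_on F t T (phi k),
            cvg0_in_probability P (fun k w =>
              (\int[lebesgue_measure]_(r in `[t, T]%classic)
                 ((simple_eval (phi k) r w - Phi r w) ^+ 2)%:E)%E) &
            forall s, t <= s <= T ->
              cvg0_in_probability P (fun k w =>
                (simple_integral (phi k) b s w - I s w)%:E)]].

(* Time of the (k+1)-st jump. *)
Definition jump_time (R : realType) (Om : Type) (K : R -> Om -> nat)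
    (k : nat) (w : Om) : R :=
  inf [set r : R | 0 <= r /\ (k < K r w)%N].

(* int_t^s gamma_X(Y_r) dH_r; Y being continuous, no left limit is needed. *)
Definition jump_integral (R : realType) (m d l1 l l2 : nat)
    (co : coefficients R m d l1 l l2) (S : jump_system R m d l1 l l2)
    (t s : R) (w : Omega S) : 'cV[R]_m :=
  \sum_(KK S t w <= k < KK S s w)
    gamma_X co (YY S (jump_time (KK S) k w) w) *m JJ S k w.

Definition weak_solution (R : realType) (m d l1 l l2 : nat)
    (co : coefficients R m d l1 l l2) (T t : R) (x : 'cV[R]_m) (y : 'cV[R]_d)
    (S : jump_system R m d l1 l l2) : Prop :=
  [/\ driving_noise co S,
      adapted_on (filt S) `[t, T]%classic (XX S)
      /\ adapted_on (filt S) `[t, T]%classic (YY S),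
      {ae Pr S, forall w : Omega S,
        (forall i, lebesgue_measure.-integrable `[t, T]%classic
           (fun r : R => (mu_X co (YY S r w) i 0)%:E)) /\
        (forall i, lebesgue_measure.-integrable `[t, T]%classic
           (fun r : R => (mu_Y co (YY S r w) i 0)%:E))} &
      exists (IX : 'I_m -> 'I_l1 -> R -> Omega S -> R)
             (IY : 'I_d -> 'I_l -> R -> Omega S -> R),
        [/\ forall i j, is_ito_integral (Pr S) (filt S)
              (fun r (w : Omega S) => BB S r w j 0) t T
              (fun r (w : Omega S) => sigma_X co (YY S r w) i j) (IX i j),
            forall i j, is_ito_integral (Pr S) (filt S)
              (fun r (w : Omega S) => WW S r w j 0) t T
              (fun r (w : Omega S) => sigma_Y co (YY S r w) i j) (IY i j) &
            {ae Pr S, forall w : Omega S, forall s, t <= s <= T ->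
              XX S s w = x
                + \col_i (\int[lebesgue_measure]_(r in `[t, s]%classic)
                            mu_X co (YY S r w) i 0)
                + \col_i (\sum_j IX i j s w)
                + jump_integral co t s w /\
              YY S s w = y
                + \col_i (\int[lebesgue_measure]_(r in `[t, s]%classic)
                            mu_Y co (YY S r w) i 0)
                + \col_i (\sum_j IY i j s w)}]].

Definition lives_in (R : realType) (m d l1 l l2 : nat) (D : set 'cV[R]_d)
    (T t : R) (S : jump_system R m d l1 l l2) : Prop :=
  {ae Pr S, forall w : Omega S, forall s, t <= s <= T -> D (YY S s w)}.

Definition same_law (R : realType) (m d l1 l l2 : nat) (T t : R)
    (S S' : jump_system R m d l1 l l2) : Prop :=
  forall (n : nat) (s : 'I_n -> R) (A : 'I_n -> set ('cV[R]_m * 'cV[R]_d)),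
    (forall i, t <= s i <= T) -> (forall i, measurable (A i)) ->
    Pr S [set w : Omega S | forall i, A i (XX S (s i) w, YY S (s i) w)] =
    Pr S' [set w : Omega S' | forall i, A i (XX S' (s i) w, YY S' (s i) w)].

(* Only the values on D of the coefficients matter: existence and uniqueness
   are those of solutions with values in R^m x D. *)
Definition weakly_well_posed (R : realType) (m d l1 l l2 : nat)
    (co : coefficients R m d l1 l l2) (D : set 'cV[R]_d) (T : R) : Prop :=
  forall t x y, 0 <= t <= T -> D y ->
    (exists S, weak_solution co T t x y S /\ lives_in D T t S) /\
    (forall S S', weak_solution co T t x y S -> lives_in D T t S ->
       weak_solution co T t x y S' -> lives_in D T t S' -> same_law T t S S').

(* u(t, x, y) = E[f(X_T^{t,x,y}, Y_T^{t,y})] *)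
Definition is_value_function (R : realType) (m d l1 l l2 : nat)
    (co : coefficients R m d l1 l l2) (D : set 'cV[R]_d) (T : R)
    (f : 'cV[R]_m -> 'cV[R]_d -> R) (u : R -> 'cV[R]_m -> 'cV[R]_d -> R) :
    Prop :=
  forall t x y (S : jump_system R m d l1 l l2), 0 <= t <= T -> D y ->
    weak_solution co T t x y S -> lives_in D T t S ->
    (Pr S).-integrable setT (fun w : Omega S => (f (XX S T w) (YY S T w))%:E) /\
    ((u t x y)%:E = \int[Pr S]_w (f (XX S T w) (YY S T w))%:E)%E.

(* Derivatives relative to a set, so as to make sense at the boundary points of
   D when D is closed. *)
Definition has_derivative_within (R : realType) (A : set R) (g : R -> R)
    (t g' : R) : Prop :=
  (fun s => (g s - g t) / (s - t)) @ within A t^' --> g'.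

(* [mx_norm] is the sup norm; any norm of R^n gives the same notion. *)
Definition has_gradient_within (R : realType) (n : nat) (A : set 'cV[R]_n)
    (g : 'cV[R]_n -> R) (z G : 'cV[R]_n) : Prop :=
  (fun z' : 'cV[R]_n => (g z' - g z - (G^T *m (z' - z)) 0 0) / mx_norm (z' - z))
    @ within A z^' --> (0 : R).

Definition has_hessian_within (R : realType) (n : nat) (A : set 'cV[R]_n)
    (g : 'cV[R]_n -> R) (z : 'cV[R]_n) (Hs : 'M[R]_n) : Prop :=
  exists G : 'cV[R]_n -> 'cV[R]_n,
    (forall z', A z' -> has_gradient_within A g z' (G z')) /\
    (forall i, has_gradient_within A (fun z' => G z' i 0) z (row i Hs)^T).

(* du/dt + Lu = 0 on [0, T[ x R^m x D, u(T, .) = f *)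
Definition solves_pide (R : realType) (m d l1 l l2 : nat)
    (co : coefficients R m d l1 l l2) (D : set 'cV[R]_d) (T : R)
    (f : 'cV[R]_m -> 'cV[R]_d -> R) (u : R -> 'cV[R]_m -> 'cV[R]_d -> R) :
    Prop :=
  (forall t x y, 0 <= t < T -> D y ->
    exists (ut : R) (Gx : 'cV[R]_m) (Hx : 'M[R]_m)
           (Gy : 'cV[R]_d) (Hy : 'M[R]_d),
      [/\ has_derivative_within `[0, T[%classic (fun s => u s x y) t ut,
          has_gradient_within setT (fun x' => u t x' y) x Gx
          /\ has_hessian_within setT (fun x' => u t x' y) x Hx,
          has_gradient_within D (u t x) y Gy
          /\ has_hessian_within D (u t x) y Hy,
          (levy_measure co).-integrable setT
            (fun z => (u t (x + gamma_X co y *m z) y - u t x y)%:E) &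
          ut + 2^-1 * \tr (sigma_X co y *m (sigma_X co y)^T *m Hx)
             + 2^-1 * \tr (sigma_Y co y *m (sigma_Y co y)^T *m Hy)
             + ((mu_X co y)^T *m Gx) 0 0 + ((mu_Y co y)^T *m Gy) 0 0
             + \int[levy_measure co]_z (u t (x + gamma_X co y *m z) y - u t x y)
          = 0]) /\
  (forall x y, D y -> u T x y = f x y).

Definition grid (R : realType) (m : nat) (X0 dx : 'cV[R]_m) : set 'cV[R]_m :=
  [set X0 + \col_i ((k i)%:~R * dx i 0) | k in [set: 'I_m -> int]].

Definition lp_norm (R : realType) (m : nat) (X0 dx : 'cV[R]_m) (p : \bar R)
    (phi : grid X0 dx -> R) : \bar R :=
  match p with
  | r%:E => ((\esum_(x in [set: grid X0 dx])
                (`|phi x| `^ r * \prod_i dx i 0)%:E) `^ r^-1)%E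
  | +oo%E => ereal_sup (range (fun x => `|phi x|%:E))
  | -oo%E => 0%E
  end.

Definition in_lp (R : realType) (m : nat) (X0 dx : 'cV[R]_m) (p : \bar R)
    (phi : grid X0 dx -> R) : Prop := (lp_norm p phi < +oo)%E.

(* Linear operators from l_p to itself; values off l_p are irrelevant. *)
Definition lp_operator (R : realType) (m : nat) (X0 dx : 'cV[R]_m) (p : \bar R)
    (Gam : (grid X0 dx -> R) -> (grid X0 dx -> R)) : Prop :=
  (forall phi, in_lp p phi -> in_lp p (Gam phi)) /\
  (forall (a : R) phi psi, in_lp p phi -> in_lp p psi ->
     Gam (fun x => a * phi x + psi x) = (fun x => a * Gam phi x + Gam psi x)).

Definition lp_opnorm (R : realType) (m : nat) (X0 dx : 'cV[R]_m) (p : \bar R)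
    (Gam : (grid X0 dx -> R) -> (grid X0 dx -> R)) : \bar R :=
  ereal_sup [set lp_norm p (Gam phi) | phi in [set phi | (lp_norm p phi <= 1)%E]].

Definition positive_step (R : realType) (m : nat) (dx : 'cV[R]_m) : Prop :=
  forall i, 0 < dx i 0.

Definition small_step (R : realType) (m : nat) (dx : 'cV[R]_m) : Prop :=
  forall i, dx i 0 < 1.

(* Admissible pairs (h, dx), with h = T / N. *)
Definition admissible (R : realType) (m : nat) (T : R) : set (R * 'cV[R]_m) :=
  [set q | (exists2 N : nat, (0 < N)%N & q.1 = T / N%:R) /\ positive_step q.2].

(* Main.v *)
(** Let [V_n] be the exponential of the sum of [c(Y_k) h] over [k < n] and let
    [N_n] be the norm in [L^p(Omega; l_p)] of [V_n] times the error of the scheme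
    at step [n], along the chain.  Consistency says that the error plus the
    remainder at step [n] is the conditional expectation of [Pi] applied to the
    error at step [n+1].  By the Markov property one may condition on the whole
    past, with respect to which [V_n] is measurable; as the inner and outer
    exponents are equal, conditional Jensen applied at each grid point separately
    shows that conditioning does not increase the norm.  Stability and
    [1 + c h <= exp(c h)] turn [V_n] into [V_(n+1)], so that
    [N_n <= N_(n+1) + K C h E], where [K = exp(c(Y_0) T)] pays for the term [k = 0],
    absent from the weight of the hypothesis on the remainder.  Since [N_N = 0],
    summing over the [N] steps gives the bound.  That [u^h_n] lies in [l_p] almost
    surely, which is needed to use the linearity of [Pi], comes out of the same
    induction. *)
Require Import Defs.
From HB Require Import structures.
From mathcomp Require Import all_boot all_order all_algebra.
From mathcomp Require Import all_classical all_reals all_analysis.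
From mathcomp Require Import measurable_realfun ess_sup_inf ring lra.
Import Order.TTheory GRing.Theory Num.Theory.
Import numFieldTopology.Exports numFieldNormedType.Exports.
Import HBNNSimple.
Local Open Scope classical_set_scope.
Local Open Scope ring_scope.

Set Implicit Arguments.
Unset Strict Implicit.
Unset Printing Implicit Defensive.

(** * Conditional expectations and the Markov property *)

Lemma integral_setE d (T : measurableType d) (R : realType)
    (mu : {measure set T -> \bar R}) (A : set T) (f : T -> R) :
  (\int[mu]_(x in A) (f x)%:E = \int[mu]_x (\1_A x * f x)%:E)%E.
Proof.
rewrite integral_mkcond; apply: eq_integral => x _.
by rewrite /= patchE indicE; case: (x \in A); rewrite ?mul1r ?mul0r.
Qed.

Lemma sigma1_measurable d (T : measurableType d) d' (E : measurableType d')
    (f : T -> E) (F : set (set T)) :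
  F `<=` measurable -> sigma1 f `<=` F -> measurable_fun setT f.
Proof.
by move=> Fm fF _ B mB; rewrite setTI; apply/Fm/fF; exists B => //; rewrite setTI.
Qed.

(** Sets of [F] give the inequality for weights that are simple functions of [G], and monotone
    convergence gives it for [G] itself. All functions being nonnegative, no integrability is
    required. *)
Lemma le_integral_weight d (T : measurableType d) (R : realType)
    (mu : {measure set T -> \bar R}) (F : set (set T)) (G a b : T -> R) :
  F `<=` measurable -> sigma1 G `<=` F -> (forall x, 0 <= G x) ->
  measurable_fun setT a -> measurable_fun setT b ->
  (forall x, 0 <= a x) -> (forall x, 0 <= b x) ->
  (forall A, F A ->
    (\int[mu]_(x in A) (a x)%:E <= \int[mu]_(x in A) (b x)%:E)%E) ->
  (\int[mu]_x (G x * a x)%:E <= \int[mu]_x (G x * b x)%:E)%E.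
Proof.
move=> Fm GF G0 ma mb a0 b0 ab.
have mG : measurable_fun setT G by exact: sigma1_measurable GF.
(* Clipping at 0 makes the identity eligible for approximation by nonnegative simple functions; it
   changes nothing on the values of [G]. *)
pose idp : R -> \bar R := fun r => (Num.max r 0)%:E.
have mid : measurable_fun setT idp.
  rewrite (_ : idp = (fun r : R => maxe r%:E 0%:E)); last first.
    by apply/funext => r; rewrite -EFin_max.
  by apply: measurable_maxe.
pose s := nnsfun_approx measurableT mid.
have scvg r : 0 <= r -> (fun n => s n r) @ \oo --> r.
  move=> r0.
  have h : forall x : R, setT x -> (0 <= idp x)%E.
    by move=> x _; rewrite lee_fin le_max lexx orbT.
  have /= := @cvg_nnsfun_approx _ _ _ _ measurableT _ mid h r I.
  by rewrite /idp (max_idPl r0) => /fine_cvg.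
have mc (c : T -> R) : measurable_fun setT c -> (forall x, 0 <= c x) ->
    ((fun n => \int[mu]_x (s n (G x) * c x)%:E) @ \oo -->
    (\int[mu]_x (G x * c x)%:E))%E.
  move=> mc c0.
  rewrite (_ : (\int[mu]_x (G x * c x)%:E)%E =
      (\int[mu]_x limn (fun n => (s n (G x) * c x)%:E))%E); last first.
    apply: eq_integral => x _; apply/esym/cvg_lim => //.
    by apply: cvg_EFin; [exact: nearW | apply: cvgMl; exact: scvg].
  apply: cvg_monotone_convergence => //.
  - move=> n; apply/measurable_EFinP; apply: measurable_funM => //.
    exact: measurableT_comp.
  - by move=> n x _; rewrite lee_fin mulr_ge0.
  - move=> x _ n k nk; rewrite lee_fin ler_wpM2r//.
    exact/lefP/nd_nnsfun_approx.
have mGs n y : measurable (G @^-1` (s n @^-1` [set y])).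
  by rewrite -[X in measurable X]setTI; exact: mG.
have expand n (c : T -> R) : measurable_fun setT c -> (forall x, 0 <= c x) ->
    (\int[mu]_x (s n (G x) * c x)%:E = \sum_(y \in range (s n))
      y%:E * \int[mu]_(x in G @^-1` (s n @^-1` [set y])) (c x)%:E)%E.
  move=> mc_ c0.
  transitivity (\int[mu]_x \sum_(y \in range (s n))
      (y * (\1_(G @^-1` (s n @^-1` [set y])) x * c x))%:E)%E.
    apply: eq_integral => x _; rewrite fimfunE fsumEFin// mulr_fsuml.
    by congr EFin; apply: eq_fsbigr => y _; rewrite -mulrA.
  have s0 y x : 0 <= y * (\1_(G @^-1` (s n @^-1` [set y])) x * c x).
    rewrite mulrA mulr_ge0// -[X in _ * X]/(\1_(s n @^-1` [set y]) (G x)).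
    by have := nnfun_muleindic_ge0 (s n) y (G x); rewrite -EFinM lee_fin.
  have mi y : measurable_fun setT
      (fun x => \1_(G @^-1` (s n @^-1` [set y])) x * c x).
    by apply: measurable_funM => //; apply: measurable_indic.
  rewrite ge0_integral_fsum//; last 2 first.
  - by move=> y; apply/measurable_EFinP; apply: measurable_funM.
  - by move=> y x _; rewrite lee_fin.
  apply: eq_fsbigr => y /set_mem[z _ <-]; rewrite integral_setE.
  under eq_integral do rewrite EFinM.
  rewrite ge0_integralZl_EFin//.
  - by move=> x _; rewrite lee_fin mulr_ge0.
  - exact/measurable_EFinP.
apply: (lee_cvg_to (mc a ma a0) (mc b mb b0)).
apply: nearW => n; rewrite !expand//; apply: lee_fsum => // y [z _ <-].

apply: lee_wpmul2l; rewrite ?lee_fin// ab//; apply: GF.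
exists (s n @^-1` [set s n z]); rewrite ?setTI//.
Qed.

(** Packages an integral as a measure, so that two densities can be compared by uniqueness of
    measures on a pi-system. *)
Lemma density_measure_exists d (T : measurableType d) (R : realType)
    (mu : {measure set T -> \bar R}) (g : T -> R) :
  measurable_fun setT g -> (forall x, 0 <= g x) ->
  exists M : {measure set T -> \bar R},
    forall A, M A = (\int[mu]_(x in A) (g x)%:E)%E.
Proof.
move=> mg g0.
pose M (A : set T) := (\int[mu]_(x in A) (g x)%:E)%E.
have M0 : M set0 = 0%E by exact: integral_set0.
have Mge0 A : (0 <= M A)%E by apply: integral_ge0 => x _; rewrite lee_fin.
have Msa : semi_sigma_additive M.
  move=> F mF tF mUF; rewrite /M ge0_integral_bigcup//; last 2 first.
  - by apply: measurable_funTS; exact/measurable_EFinP.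
  - by move=> x _; rewrite lee_fin.
  by apply: is_cvg_ereal_nneg_natsum_cond => n _ _; exact: Mge0.
pose mM := isMeasure.Build d T R M M0 Mge0 Msa.
pose Mm : {measure set T -> \bar R} := HB.pack M mM.
by exists Mm.
Qed.

Lemma eq_integral_weight d (T : measurableType d) (R : realType)
    (mu : {measure set T -> \bar R}) (F : set (set T)) (G a b : T -> R) :
  F `<=` measurable -> sigma1 G `<=` F -> (forall x, 0 <= G x) ->
  measurable_fun setT a -> measurable_fun setT b ->
  (forall x, 0 <= a x) -> (forall x, 0 <= b x) ->
  (forall A, F A ->
    (\int[mu]_(x in A) (a x)%:E = \int[mu]_(x in A) (b x)%:E)%E) ->
  (\int[mu]_x (G x * a x)%:E = \int[mu]_x (G x * b x)%:E)%E.
Proof.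
move=> Fm GF G0 ma mb a0 b0 ab; apply/eqP; rewrite eq_le.
by apply/andP; split; apply: (le_integral_weight Fm GF) => // A FA;
  rewrite ab.
Qed.

Lemma sigma1_sub_measurable d (T : measurableType d) d' (E : measurableType d')
    (Y : T -> E) : measurable_fun setT Y -> sigma1 Y `<=` measurable.
Proof. by move=> mY _ [B mB <-]; exact: mY. Qed.

Lemma sigma1_comp d (T : measurableType d) d' (E : measurableType d')
    d'' (E' : measurableType d'') (Y : T -> E) (f : E -> E') :
  measurable_fun setT f -> sigma1 (f \o Y) `<=` sigma1 Y.
Proof.
move=> mf _ [B mB <-]; exists (f @^-1` B); last by rewrite !setTI.
by rewrite -[X in measurable X]setTI; exact: mf.
Qed.

Lemma sigma1_comp_on d (T : measurableType d) d' (E : measurableType d')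
    d'' (E' : measurableType d'') (Y : T -> E) (S : set E) (f : E -> E') :
  measurable S -> (forall w, S (Y w)) -> measurable_fun S f ->
  sigma1 (f \o Y) `<=` sigma1 Y.
Proof.
move=> mS SY mf _ [B mB <-]; exists (S `&` f @^-1` B); first exact: mf.
by rewrite !setTI; apply/seteqP; split => w //= [].
Qed.

Lemma pushforward_exists d (T : measurableType d) d' (E : measurableType d')
    (R : realType) (mu : {measure set T -> \bar R}) (Y : T -> E) :
  measurable_fun setT Y ->
  exists nu : {measure set E -> \bar R}, forall B, nu B = mu (Y @^-1` B).
Proof.
move=> mY; unshelve eexists (pushforward mu Y : {measure set E -> \bar R}) => //.
Qed.

(** [q] is the Radon-Nikodym density of [B |-> P(Y in B, A)] with respect to the law of [Y], that
    is, [q (Y)] is a version of [P(A | Y)]. *)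
Lemma conditional_probability_exists d (T : measurableType d) (R : realType)
    (P : probability T R) d' (E : measurableType d') (Y : T -> E) (A : set T) :
  measurable_fun setT Y -> measurable A ->
  exists q : E -> R, [/\ measurable_fun setT q, forall y, 0 <= q y &
    forall B, measurable B ->
      (\int[P]_(x in Y @^-1` B) (\1_A x)%:E =
       \int[P]_(x in Y @^-1` B) (q (Y x))%:E)%E].
Proof.
move=> mY mA.
pose Ym : {mfun T >-> E} := HB.pack Y (isMeasurableFun.Build _ _ _ _ Y mY).
pose law := distribution P Ym.
have [nu0 nuE] : exists nu : {measure set E -> \bar R},
    forall B, nu B = P (Y @^-1` B `&` A).
  by have [nu nuE] := pushforward_exists (mrestr P mA) mY; exists nu.
have mYB B : measurable B -> measurable (Y @^-1` B).
  by move=> mB; have := mY measurableT _ mB; rewrite setTI.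
have nu0T : (nu0 setT < +oo)%E.
  by rewrite nuE preimage_setT setTI ltey_eq fin_num_measure.
(* Restriction to the whole space changes no value; it equips [nu0] with the finite-measure
   structure that Radon-Nikodym asks for. *)
pose nu := mfrestr measurableT nu0T.
have nu0E B : nu B = nu0 B by rewrite /nu /mfrestr /mrestr setIT.
have nulaw : nu `<< law.
  apply/null_content_dominatesP => B mB /= lB; apply/eqP.
  have PB0 : P (Y @^-1` B) = 0%E by exact: lB.
  rewrite [nu B](_ : _ = P (Y @^-1` B `&` A)); last by rewrite -nuE -nu0E.
  rewrite -measure_le0 -[leRHS]PB0; apply: le_measure; rewrite ?inE//.
  - by apply: measurableI => //; exact: mYB.
  - exact: mYB.
have [f [f0 ffin /measurable_int mf fE]] := radon_nikodym_sigma_finite nulaw.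
exists (fine \o f); split.
- exact: measurableT_comp.
- by move=> y; exact: fine_ge0.
- move=> B mB; rewrite integral_indic//; last exact: mYB.
  transitivity (nu B); first by rewrite nu0E nuE setIC.
  transitivity (\int[law]_(x in B) f x)%E; first exact: fE.
  rewrite /law ge0_integral_pushforward//; last first.
    exact: measurable_funTS.
  by apply: eq_integral => x _ /=; rewrite fineK.
Qed.

(* [g \o Y] is a version of the conditional expectation of [h >= 0], so it may be
   negative on a null set. *)
Lemma integral_condexp_pos d (T : measurableType d) (R : realType)
    (P : probability T R) d1 (E1 : measurableType d1)
    (F : set (set T)) (Y : T -> E1) (h : T -> R) (g : E1 -> R) (A : set T) :
  F `<=` measurable -> sigma1 Y `<=` F -> setI_closed F ->
  measurable_fun setT h -> (forall w, 0 <= h w) -> measurable_fun setT g ->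
  (forall A', F A' -> (\int[P]_(w in A') (h w)%:E =
                     \int[P]_(w in A') (g (Y w))%:E)%E) ->
  F A -> (\int[P]_(w in A) (h w)%:E =
    \int[P]_(w in A) (Num.max (g (Y w)) 0)%:E)%E.
Proof.
move=> Fm YF FI mh h0 mg gE FA.
have mY : measurable_fun setT Y by exact: sigma1_measurable YF.
have mgY : measurable_fun setT (fun w => Num.max (g (Y w)) 0).
  by apply: measurable_maxr => //; exact: measurableT_comp.
pose U := Y @^-1` (g @^-1` `[0, +oo[).
pose N := Y @^-1` (g @^-1` `]-oo, 0[).
have UN : A = (A `&` U) `|` (A `&` N).
  rewrite -setIUr (_ : U `|` N = setT) ?setIT//.
  apply/seteqP; split => // w _; rewrite /U /N /= !in_itv/= andbT.
  by case: (leP 0 (g (Y w))); [left | right].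
have FgY (I : set R) : measurable I -> F (A `&` Y @^-1` (g @^-1` I)).
  move=> mI; apply: FI => //; apply: YF; exists (g @^-1` I).
    by rewrite -[X in measurable X]setTI; exact: mg.
  by rewrite setTI.
have FU : F (A `&` U) by exact: FgY.
have FN : F (A `&` N) by exact: FgY.
have dUN : [disjoint A `&` U & A `&` N].
  apply/disj_setPS => w [[_ Uw] [_ Nw]].
  by move: Uw Nw; rewrite /U /N /= !in_itv/= andbT ltNge => ->.
have spl (k : T -> R) : measurable_fun setT k -> (forall w, 0 <= k w) ->
    (\int[P]_(w in A) (k w)%:E = \int[P]_(w in A `&` U) (k w)%:E +
      \int[P]_(w in A `&` N) (k w)%:E)%E.
  move=> mk k0; rewrite {1}UN ge0_integral_setU//; try exact: Fm.
    by apply: measurable_funTS; exact/measurable_EFinP.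
  by move=> x _; rewrite lee_fin.
rewrite (spl _ mh h0) (spl _ mgY); last first.
  by move=> w; rewrite le_max lexx orbT.
congr (_ + _)%E.
  rewrite gE//; apply: eq_integral => w /set_mem[_].
  by rewrite /U /= in_itv/= andbT => /max_idPl ->.
(* On [A] intersected with [N] the integral of [h] is that of [g (Y) < 0]; being also nonnegative,
   it vanishes, as does the integral of the positive part. *)
transitivity (0 : \bar R)%E.
  apply/eqP; rewrite eq_le; apply/andP; split.
    have gN w : (A `&` N) w -> (0 <= (- g (Y w))%:E)%E.
      by move=> [_]; rewrite /N /= in_itv/= lee_fin oppr_ge0; exact: ltW.
    rewrite gE// (eq_integral (fun w => - (- g (Y w))%:E)%E); last first.
      by move=> w _; rewrite EFinN oppeK.
    by rewrite integral_ge0N// oppe_le0; exact: integral_ge0.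
  by apply: integral_ge0 => w _; rewrite lee_fin.
symmetry; apply: integral0_eq => w [_].
by rewrite /N /= in_itv/= => /ltW/max_idPr ->.
Qed.

(* With [q (Y) = P(A | Y)] one has [E[phi; A] = E[q (Y) phi]] for every
   [phi >= 0] measurable with respect to [(Y, Y')]: on rectangles this is the Markov
   property.  Hence an inequality on [sigma(Y)] extends to [F]. *)
Lemma markov_integral_le d (T : measurableType d) (R : realType)
    (P : probability T R) d1 (E1 : measurableType d1) d2 (E2 : measurableType d2)
    (F : set (set T)) (Y : T -> E1) (Y' : T -> E2) (xi Z : T -> R) (A : set T) :
  F `<=` measurable -> sigma1 Y `<=` F -> setI_closed F ->
  measurable_fun setT Y' ->
  (forall B, measurable B -> exists g : E1 -> R,
     measurable_fun setT g /\
     forall A', F A' -> (\int[P]_(w in A') (\1_(Y' @^-1` B) w)%:E =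
                     \int[P]_(w in A') (g (Y w))%:E)%E) ->
  sigma1 xi `<=` sigma1 Y ->
  sigma1 Z `<=` sigma1 (fun w => (Y w, Y' w)) ->
  (forall w, 0 <= xi w) -> (forall w, 0 <= Z w) ->
  (forall A', sigma1 Y A' ->
     (\int[P]_(w in A') (xi w)%:E <= \int[P]_(w in A') (Z w)%:E)%E) ->
  F A -> (\int[P]_(w in A) (xi w)%:E <= \int[P]_(w in A) (Z w)%:E)%E.
Proof.
move=> Fm YF FI mY' markov xiY ZYY xi0 Z0 xiZ FA.
have mA := Fm _ FA.
have mY : measurable_fun setT Y by exact: sigma1_measurable YF.
have mYY : measurable_fun setT (fun w => (Y w, Y' w)).
  exact: measurable_fun_pair.
have sYm := sigma1_sub_measurable mY.
have sYYm := sigma1_sub_measurable mYY.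
have mxi : measurable_fun setT xi by exact: sigma1_measurable xiY.
have mZ : measurable_fun setT Z by exact: sigma1_measurable ZYY.
have [q [mq q0 qE]] := conditional_probability_exists P mY mA.
have mqY : measurable_fun setT (q \o Y) by exact: measurableT_comp.
have qE1 A' : sigma1 Y A' ->
   (\int[P]_(x in A') (\1_A x)%:E = \int[P]_(x in A') ((q \o Y) x)%:E)%E.
  by move=> [B mB <-]; rewrite setTI qE.
have m1A : measurable_fun setT (\1_A : T -> R) by exact: measurable_indic.
have indic_ge0 (D : set T) w : 0 <= \1_D w :> R by rewrite indicE ler0n.
(* Both sides equal the integral of [1_B1(Y) q(Y) gp(Y)]. On the left, the Markov property on [A]
   and [S] trades [1_D] for [gp(Y)], after which [1_A] is traded for [q(Y)]; on the right, [1_D] is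
   traded for [gp(Y)]. *)
have rectE B1 B2 : measurable B1 -> measurable B2 ->
    (\int[P]_(w in (fun w => (Y w, Y' w)) @^-1` (B1 `*` B2)) (\1_A w)%:E =
     \int[P]_(w in (fun w => (Y w, Y' w)) @^-1` (B1 `*` B2)) ((q \o Y) w)%:E)%E.
  move=> mB1 mB2.
  set S := Y @^-1` B1; set D := Y' @^-1` B2.
  have -> : (fun w => (Y w, Y' w)) @^-1` (B1 `*` B2) = S `&` D by [].
  have mS : measurable S by rewrite -[X in measurable X]setTI; exact: mY.
  have mD : measurable D by rewrite -[X in measurable X]setTI; exact: mY'.
  have FS : F S by apply: YF; exists B1 => //; rewrite setTI.
  have [g [mg gE]] := markov _ mB2; rewrite -/D in gE.
  pose gp y := Num.max (g y) 0.
  have mgp : measurable_fun setT gp by exact: measurable_maxr.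
  have gp0 y : 0 <= gp y by rewrite le_max lexx orbT.
  have mgpY : measurable_fun setT (gp \o Y) by exact: measurableT_comp.
  have m1D : measurable_fun setT (\1_D : T -> R) by exact: measurable_indic.
  have gpE A' : F A' -> (\int[P]_(w in A') (\1_D w)%:E =
                     \int[P]_(w in A') ((gp \o Y) w)%:E)%E.
    move=> FA'.
    exact: integral_condexp_pos FA'.
  transitivity (\int[P]_(w in A `&` S) (\1_D w)%:E)%E.
    rewrite [LHS]integral_setE [RHS]integral_setE; apply: eq_integral => w _.
    by rewrite !indicI/= mulrC mulrA.
  rewrite gpE; last exact: FI.
  transitivity (\int[P]_w (((\1_B1 \* gp) \o Y) w * \1_A w)%:E)%E.
    rewrite integral_setE; apply: eq_integral => w _; congr EFin.
    by rewrite indicI/= -mulrA mulrC.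
  have m1gp : measurable_fun setT (\1_B1 \* gp)%R.
    by apply: measurable_funM => //; exact: measurable_indic.
  have m1q : measurable_fun setT (\1_B1 \* q)%R.
    by apply: measurable_funM => //; exact: measurable_indic.
  have gp1 w : 0 <= ((\1_B1 \* gp) \o Y) w.
    by apply: mulr_ge0 => //; rewrite indicE ler0n.
  have q1 w : 0 <= ((\1_B1 \* q) \o Y) w.
    by apply: mulr_ge0 => //; rewrite indicE ler0n.
  have gpE1 A' : sigma1 Y A' -> (\int[P]_(w in A') (\1_D w)%:E =
                     \int[P]_(w in A') ((gp \o Y) w)%:E)%E.
    by move=> A'Y; apply: gpE; exact: YF.
  have qY0 w : 0 <= (q \o Y) w by exact: q0.
  have gpY0 w : 0 <= (gp \o Y) w by exact: gp0.
  rewrite (eq_integral_weight sYm (sigma1_comp m1gp) gp1 m1A mqY)//.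
  transitivity (\int[P]_w (((\1_B1 \* q) \o Y) w * (gp \o Y) w)%:E)%E.
    by apply: eq_integral => w _; congr EFin; rewrite /= mulrAC.
  rewrite -(eq_integral_weight sYm (sigma1_comp m1q) q1 m1D mgpY)//.
  rewrite [RHS]integral_setE; apply: eq_integral => w _; congr EFin.
  by rewrite indicI/= mulrAC.
have qEYY A' : sigma1 (fun w => (Y w, Y' w)) A' ->
   (\int[P]_(x in A') (\1_A x)%:E = \int[P]_(x in A') ((q \o Y) x)%:E)%E.
  (* The measures with densities [1_A] and [q(Y)] have images under [(Y, Y')] that agree on
     rectangles, a pi-system generating the product sigma-algebra. *)
  have [M1 M1E] := density_measure_exists P m1A (indic_ge0 A).
  have [M2 M2E] := density_measure_exists P mqY (fun x => q0 (Y x)).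
  have [nu1 nu1E] := pushforward_exists M1 mYY.
  have [nu2 nu2E] := pushforward_exists M2 mYY.
  move=> [C mC <-]; rewrite setTI -M1E -M2E -nu1E -nu2E.
  pose rect : set (set (E1 * E2)) :=
    [set B1 `*` B2 | B1 in measurable & B2 in measurable].
  have rectI : setI_closed rect.
    move=> _ _ [B1 mB1 [B2 mB2 <-]] [C1 mC1 [C2 mC2 <-]].
    exists (B1 `&` C1); first exact: measurableI.
    exists (B2 `&` C2); first exact: measurableI.
    by rewrite setXI.
  apply: (measure_unique rect (fun=> setT)) => //.
  - exact: measurable_prod_measurableType.
  - by move=> _; exists setT => //; exists setT => //; rewrite setXTT.
  - by rewrite bigcup_const.
  - move=> _ [B1 mB1 [B2 mB2 <-]]; rewrite nu1E nu2E M1E M2E.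
    exact: rectE.
  - move=> _; rewrite nu1E M1E preimage_setT integral_indic// setIT.
    by rewrite ltey_eq fin_num_measure.
have qY0 w : 0 <= (q \o Y) w by exact: q0.
(* Once [1_A] has been replaced by [q(Y)] on both sides, the claim is the hypothesis on [sigma(Y)]
   with a weight measurable with respect to [Y]. *)
rewrite [leLHS]integral_setE [leRHS]integral_setE.
under eq_integral do rewrite mulrC.
under [leRHS]eq_integral do rewrite mulrC.
rewrite (eq_integral_weight sYm xiY xi0 m1A mqY)//.
rewrite (eq_integral_weight sYYm ZYY Z0 m1A mqY)//.
under eq_integral do rewrite mulrC.
under [leRHS]eq_integral do rewrite mulrC.
apply: (le_integral_weight sYm) => //.
exact: sigma1_comp.
Qed.

(** * Conditional Jensen inequality *)

(** Conditional Jensen for the power [r], in integrated form. The hypothesis is tested against the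
    [F]-measurable weight [f ^ (r - 1)], and Young's inequality separates the product
    [f ^ (r - 1) * g]. *)
Lemma le_integral_powR d (T : measurableType d) (R : realType)
    (P : probability T R) (F : set (set T)) (f g : T -> R) (r : R) :
  F `<=` measurable -> F setT -> sigma1 f `<=` F -> measurable_fun setT g ->
  (forall x, 0 <= f x) -> (forall x, 0 <= g x) -> 1 <= r ->
  (forall A, F A ->
    (\int[P]_(x in A) (f x)%:E <= \int[P]_(x in A) (g x)%:E)%E) ->
  (\int[P]_x (f x `^ r)%:E <= \int[P]_x (g x `^ r)%:E)%E.
Proof.
move=> Fm FT fF mg f0 g0 r1 fg.
have mf : measurable_fun setT f by exact: sigma1_measurable fF.
move: r1; rewrite le_eqVlt => /predU1P[<-|r1].
  rewrite (eq_integral (fun x => (f x)%:E)) => [|x _]; last by rewrite powRr1.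
  rewrite [leRHS](eq_integral (fun x => (g x)%:E)) => [|x _]; last by rewrite powRr1.
  exact: fg.
have r0 : 0 < r by exact: lt_trans r1.
pose phi (k : nat) (y : R) := y `^ (r - 1) * \1_(`]-oo, k%:R]%classic) y.
have mphi k : measurable_fun setT (phi k).
  by apply: measurable_funM; [exact: measurable_powR | exact: measurable_indic].
have phi0 k y : 0 <= phi k y by rewrite mulr_ge0 ?powR_ge0// indicE ler0n.
have phiE k y : 0 <= y -> phi k y * y = y `^ r * \1_(`]-oo, k%:R]%classic) y.
  move=> y0; rewrite /phi mulrAC -{2}(powRr1 y0) -powRD; last first.
    by rewrite subrK gt_eqF.
  by rewrite subrK.
have mphif k : measurable_fun setT (fun x => phi k (f x) * f x).
  by apply: measurable_funM => //; exact: measurableT_comp.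
have mgr : measurable_fun setT (fun x => g x `^ r).
  exact: (measurableT_comp (measurable_powR r) mg).
(* Truncating [f] at [k] makes the left-hand side finite, so that its multiple
   coming from Young's inequality can be absorbed. *)
have bound k : (\int[P]_x (phi k (f x) * f x)%:E <= \int[P]_x (g x `^ r)%:E)%E.
  set I := (leLHS); set J := (leRHS).
  have I0 : (0 <= I)%E.
    by apply: integral_ge0 => x _; rewrite lee_fin mulr_ge0.
  have J0 : (0 <= J)%E.
    by apply: integral_ge0 => x _; rewrite lee_fin powR_ge0.
  have Ifin : I \is a fin_num.
    rewrite ge0_fin_numE//; apply: (@le_lt_trans _ _ (\int[P]_x (k%:R `^ r)%:E)%E).
      apply: ge0_le_integral => //.
      - by move=> x _; rewrite lee_fin mulr_ge0.
      - exact/measurable_EFinP.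
      - move=> x _; rewrite lee_fin phiE// indicE.
        case: (boolP (f x \in `]-oo, k%:R]%classic)) => fk /=; last first.
          by rewrite mulr0 powR_ge0.
        have {}fk : f x <= k%:R by move: fk => /set_mem; rewrite /= in_itv.
        by rewrite mulr1 ge0_ler_powR ?nnegrE// ltW.
    rewrite integral_cst//. by rewrite ltey_eq fin_numM// fin_num_measure.
  (* The conjugate exponents are [r / (r - 1)] and [r], so that the first power restores [f ^ r]. *)
  have young x : phi k (f x) * g x <=
      (1 - r^-1) * (phi k (f x) * f x) + r^-1 * (g x `^ r).
    rewrite phiE//; case: (boolP (f x \in `]-oo, k%:R]%classic)) => fk;
      rewrite /phi indicE ?fk ?(negPf fk)/= ?mulr1 ?mulr0; last first.
      by rewrite !(mulr0, mul0r, add0r) mulr_ge0 ?powR_ge0// invr_ge0 ltW.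
    have r10 : 0 < r - 1 by rewrite subr_gt0.
    have := @conjugate_powR _ (f x `^ (r - 1)) (g x) (r / (r - 1)) r
      (powR_ge0 _ _) (g0 x) (divr_gt0 r0 r10) r0.
    rewrite -powRrM mulrCA mulfV ?gt_eqF// mulr1 invf_div.
    have -> : (r - 1) / r = 1 - r^-1 by field; rewrite gt_eqF.
    by rewrite subrK => /(_ erefl) h; lra.
  (* As [I] is finite, [(1 - 1/r) I] can be subtracted, leaving [I / r <= J / r]. *)
  have : (I <= (1 - r^-1)%:E * I + r^-1%:E * J)%E.
    have IG : (I <= \int[P]_x (phi k (f x) * g x)%:E)%E.
      apply: (@le_integral_weight _ _ _ P _ (phi k \o f) _ _ Fm) => //.
      - exact: subset_trans (sigma1_comp (mphi k)) fF.
      - by move=> x; exact: phi0.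
    apply: (le_trans IG).
    rewrite -ge0_integralZl_EFin//; last 3 first.
    - by move=> x _; rewrite lee_fin mulr_ge0.
    - exact/measurable_EFinP.
    - by rewrite subr_ge0 invf_le1// ltW.
    rewrite -ge0_integralZl_EFin//; last 3 first.
    - by move=> x _; rewrite lee_fin powR_ge0.
    - exact/measurable_EFinP.
    - by rewrite invr_ge0 ltW.
    rewrite -ge0_integralD//; last 4 first.
    - move=> x _; rewrite -EFinM lee_fin.
      apply: mulr_ge0; last by apply: mulr_ge0.
      by rewrite subr_ge0 invf_le1// ltW.
    - by apply: measurable_funeM; exact/measurable_EFinP.
    - by move=> x _; rewrite -EFinM lee_fin !mulr_ge0 ?powR_ge0// invr_ge0 ltW.
    - by apply: measurable_funeM; exact/measurable_EFinP.
    apply: ge0_le_integral => //.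
    - by move=> x _; rewrite lee_fin; apply: mulr_ge0.
    - apply/measurable_EFinP; apply: measurable_funM => //.
      exact: measurableT_comp.
    - by apply: emeasurable_funD; apply: measurable_funeM; exact/measurable_EFinP.
    - by move=> x _; rewrite -!EFinM -EFinD lee_fin; exact: young.
  move: J0 I0 Ifin; case: J => [j| |]//; case: I => [i| |]//; rewrite ?leey//.
  move=> _ _ _; rewrite -!EFinM -EFinD !lee_fin => ij.
  have s0 : 0 < r^-1 by rewrite invr_gt0.
  by rewrite -(ler_pM2l s0); lra.
have -> : (\int[P]_x (f x `^ r)%:E =
    \int[P]_x limn (fun k => (phi k (f x) * f x)%:E))%E.
  apply: eq_integral => x _; apply/esym/cvg_lim => //.
  apply: cvg_near_cst; near=> k; rewrite phiE// indicE mem_set ?mulr1//=.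
  by rewrite in_itv/=; near: k; exact: nbhs_infty_ger.
rewrite monotone_convergence//; last 3 first.
- by move=> k; exact/measurable_EFinP.
- by move=> k x _; rewrite lee_fin mulr_ge0.
- move=> x _ k l kl; rewrite lee_fin !phiE// ler_wpM2l ?powR_ge0// !indicE.
  case: (boolP (f x \in `]-oo, k%:R]%classic)) => // /set_mem/=.
  rewrite in_itv/= => fk; rewrite mem_set//= in_itv/= (le_trans fk)//.
  by rewrite ler_nat.
apply: lime_le; last by apply: nearW => k; exact: bound.
apply: ereal_nondecreasing_is_cvgn => k l kl; apply: ge0_le_integral => //.
- by move=> x _; rewrite lee_fin mulr_ge0.
- exact/measurable_EFinP.
- exact/measurable_EFinP.
- move=> x _; rewrite lee_fin !phiE// ler_wpM2l ?powR_ge0// !indicE.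
  case: (boolP (f x \in `]-oo, k%:R]%classic)) => // /set_mem/=.
  rewrite in_itv/= => fk; rewrite mem_set//= in_itv/= (le_trans fk)//.
  by rewrite ler_nat.
Unshelve. all: by end_near. Qed.

(** Counterpart of Jensen for the exponent [+oo]. The set where [f > m] belongs to [F]; on it the
    integral of [f - m] is at most that of [g - m], hence at most 0, so the set is null. *)
Lemma ae_le_of_integral_le d (T : measurableType d) (R : realType)
    (P : probability T R) (F : set (set T)) (f g : T -> R) (M : \bar R) :
  F `<=` measurable -> sigma1 f `<=` F -> measurable_fun setT g ->
  (forall x, 0 <= f x) -> (forall x, 0 <= g x) ->
  (forall A, F A ->
    (\int[P]_(x in A) (f x)%:E <= \int[P]_(x in A) (g x)%:E)%E) ->
  {ae P, forall x, ((g x)%:E <= M)%E} -> {ae P, forall x, ((f x)%:E <= M)%E}.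
Proof.
move=> Fm fF mg f0 g0 fg gM.
have mf : measurable_fun setT f by exact: sigma1_measurable fF.
have [M0|M0] := ltP M 0%E.
  by apply: filterS gM => x /le_lt_trans/(_ M0); rewrite lte_fin ltNge g0.
case: M M0 gM => [m| |]//; last by move=> _ _; apply: nearW => x; rewrite leey.
rewrite lee_fin => m0 gM.
pose A := f @^-1` `]m, +oo[.
have FA : F A by apply: fF; exists `]m, +oo[%classic => //; rewrite setTI.
have mA := Fm _ FA.
have AE x : A x -> m < f x by rewrite /A /= in_itv/= andbT.
have h1 : (\int[P]_(x in A) (f x)%:E =
    \int[P]_(x in A) (f x - m)%:E + \int[P]_(x in A) m%:E)%E.
  rewrite -ge0_integralD//.
  - by apply: eq_integral => x _; rewrite -EFinD subrK.
  - by move=> x Ax; rewrite lee_fin subr_ge0 ltW// AE.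
  - by apply: measurable_funTS; apply/measurable_EFinP; exact: measurable_funB.
have h2 : (\int[P]_(x in A) (g x)%:E <= \int[P]_(x in A) m%:E)%E.
  apply: ae_ge0_le_integral => //.
  - by move=> x _; rewrite lee_fin.
  - by apply: measurable_funTS; apply/measurable_EFinP.
  - by apply: filterS gM => x + _.
have h3 : (\int[P]_(x in A) `|(f x - m)%:E| = 0)%E.
  rewrite (eq_integral (fun x => (f x - m)%:E)); last first.
    move=> x /set_mem Ax; rewrite gee0_abs// lee_fin subr_ge0.
    exact/ltW/AE.
  have := le_trans (fg _ FA) h2; rewrite h1 integral_cst//.
  have mPfin : (m%:E * P A)%E \is a fin_num by rewrite fin_numM// fin_num_measure.
  rewrite -[leRHS]add0e leeD2rE// => le0; apply/eqP; rewrite eq_le le0/=.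
  by apply: integral_ge0 => x Ax; rewrite lee_fin subr_ge0 ltW// AE.
have : ae_eq P A (fun x => (f x - m)%:E) (cst 0%E).
  apply/ae_eq_integral_abs => //.
  by apply: measurable_funTS; apply/measurable_EFinP; exact: measurable_funB.
apply: filterS => x fx; rewrite lee_fin leNgt; apply/negP => mfx.
have /fx [] : A x by rewrite /A /= in_itv/= andbT.
by move/eqP; rewrite subr_eq0 gt_eqF.
Qed.

(** * The spaces l_p of the grid *)

(** Turns sums over the grid into series over [nat], to which monotone convergence and the counting
    measure apply. [g] inverts an injection into [nat]; indices outside its range are sent to [None]
    and contribute 0. *)
Lemma esum_enum (R : realType) (T : choiceType) : countable [set: T] ->
  exists g : nat -> option T, (forall x, exists n, g n = Some x) /\
    forall a : T -> \bar R, (forall x, (0 <= a x)%E) ->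
      (\esum_(x in [set: T]) a x = \sum_(n <oo) oapp a 0 (g n))%E.
Proof.
move=> /countable_injP[f finj].
have {}finj : injective f by move=> x y; apply: finj; rewrite inE.
pose g n := if pselect (exists x, f x = n) is left h then Some (projT1 (cid h)) else None.
have gf x : g (f x) = Some x.
  rewrite /g; case: pselect => [h|[]]; last by exists x.
  by congr Some; apply: finj; exact: projT2 (cid h).
exists g; split=> [x|a a0]; first by exists (f x).
rewrite nneseries_esumT; last by move=> n; case: (g n).
have -> : (\esum_(x in [set: T]) a x =
    \esum_(x in [set: T]) oapp a 0 (g (f x)))%E.
  by apply: eq_esum => x _; rewrite gf.
rewrite -(@esum_image _ _ _ setT f (fun n => oapp a 0%E (g n))); last first.
  by move=> x y _ _; exact: finj.
rewrite esum_mkcond; apply: eq_esum => n _; case: ifPn => // /negP nf.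
rewrite /g; case: pselect => // -[x fx]; exfalso.
by apply: nf; apply/mem_set; exists x.
Qed.

Lemma countable_grid (R : realType) (m : nat) (X0 dx : 'cV[R]_m) :
  countable [set: grid X0 dx].
Proof.
have cg : countable (grid X0 dx).
  pose G (k : {ffun 'I_m -> int}) := X0 + \col_i ((k i)%:~R * dx i 0).
  have -> : grid X0 dx = G @` setT.
    apply/seteqP; split => [_ [k _ <-]|_ [k _ <-]].
      exists [ffun i => k i] => //; rewrite /G; congr (_ + _).
      by apply/matrixP => i j; rewrite !mxE ffunE.
    by exists k.
  exact: (sub_countable (card_image_le _ _) (countableP _)).
have /countable_injP[f finj] := cg.
apply/countable_injP; exists (f \o val) => x y _ _ /= /finj fxy.
by apply: val_inj; apply: fxy; apply/mem_set; exact: set_valP.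
Qed.

Section lp_norm_theory.
Context (R : realType) (m : nat) (X0 dx : 'cV[R]_m) (dx0 : positive_step dx).
Implicit Types phi psi : grid X0 dx -> R.

Lemma step_volume_gt0 : 0 < \prod_i dx i 0.
Proof. exact: prodr_gt0. Qed.

(** Over an empty grid the supremum defining the norm for [p = +oo] would be [-oo], not 0. *)
Lemma grid_nonempty : exists x : grid X0 dx, True.
Proof.
have : grid X0 dx X0.
  exists (fun=> 0) => //; rewrite -[RHS]addr0; congr (_ + _).
  by apply/matrixP => i j; rewrite !mxE mul0r.
by move=> /mem_set h; exists (exist _ X0 h).
Qed.

Lemma lp_norm_ge0 p phi : (0 <= lp_norm p phi)%E.
Proof.
case: p => [r| |]//=; first exact: poweR_ge0.
have [x _] := grid_nonempty.
apply: (@le_trans _ _ `|phi x|%:E); first by rewrite lee_fin.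
by apply: ereal_sup_ubound; exists x.
Qed.

Lemma le_lp_normy phi x : (`|phi x|%:E <= lp_norm +oo phi)%E.
Proof. by apply: ereal_sup_ubound; exists x. Qed.

Lemma poweR_lp_norm (r : R) phi : r != 0 ->
  (lp_norm r%:E phi `^ r =
   \esum_(x in [set: grid X0 dx]) (`|phi x| `^ r * \prod_i dx i 0)%:E)%E.
Proof.
move=> r0; rewrite /lp_norm -poweRrM mulVf// poweRe1//.
apply: esum_ge0 => x _; rewrite lee_fin mulr_ge0 ?powR_ge0//.
exact/ltW/step_volume_gt0.
Qed.

Lemma lp_normZ p (c : R) phi : (1 <= p)%E -> 0 < c ->
  lp_norm p (fun x => c * phi x) = (c%:E * lp_norm p phi)%E.
Proof.
case: p => [r| |]//; rewrite ?lee_fin => p1 c0; last first.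
  rewrite /lp_norm -ereal_sup_pZl//; congr ereal_sup.
  apply/seteqP; split => [_ [x _ <-]|_ [_ [x _ <-] <-]].
    exists (`|phi x|%:E); first by exists x.
    by rewrite -EFinM normrM (gtr0_norm c0).
  by exists x => //; rewrite -EFinM normrM (gtr0_norm c0).
have r0 : r != 0 by rewrite gt_eqF// (lt_le_trans ltr01).
have W0 := step_volume_gt0.
have [g [_ gE]] := @esum_enum R _ (@countable_grid R m X0 dx).
have t0 phi' x : (0 <= (`|phi' x| `^ r * \prod_i dx i 0)%:E)%E.
  by rewrite lee_fin mulr_ge0 ?powR_ge0 ?ltW.
rewrite /lp_norm (gE _ (t0 (fun x => c * phi x))) (gE _ (t0 phi)).
rewrite (_ : (\sum_(n <oo) _ = (c `^ r)%:E * \sum_(n <oo)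
    oapp (fun x => (`|phi x| `^ r * \prod_i dx i 0)%:E) 0 (g n))%E); last first.
  rewrite -nneseriesZl; last first.
    by move=> n _; case: (g n) => [x|] //=; exact: t0.
  apply: eq_eseriesr => n _; case: (g n) => [x|] /=; last by rewrite mule0.
  by rewrite -EFinM normrM powRM// (gtr0_norm c0) mulrA.
rewrite poweRM ?lee_fin ?powR_ge0//; last first.
  by apply: nneseries_ge0 => n _ _; case: (g n) => [x|] //=; exact: t0.
by rewrite poweR_EFin -powRrM mulfV// powRr1// ltW.
Qed.

Lemma lp_norm0 p : (1 <= p)%E -> lp_norm p (fun _ : grid X0 dx => 0) = 0%E.
Proof.
case: p => [r| |]//; rewrite ?lee_fin => p1; last first.
  apply/eqP; rewrite eq_le lp_norm_ge0 andbT.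
  by apply: ge_ereal_sup => _ [x _ <-]; rewrite normr0.
have r0 : r != 0 by rewrite gt_eqF// (lt_le_trans ltr01).
rewrite /lp_norm esum1 ?poweR0r ?invr_eq0// => x _.
by rewrite normr0 powR0// mul0r.
Qed.

Lemma lp_normD p phi psi : (1 <= p)%E ->
  (lp_norm p (fun x => phi x + psi x)%R <= lp_norm p phi + lp_norm p psi)%E.
Proof.
case: p => [r| |]//; rewrite ?lee_fin => p1; last first.
  apply: ge_ereal_sup => _ [x _ <-].
  have h : `|phi x + psi x| <= `|phi x| + `|psi x| by exact: ler_normD.
  have {}h : (`|phi x + psi x|%:E <= `|phi x|%:E + `|psi x|%:E)%E by rewrite -EFinD lee_fin.
  apply: (le_trans h).
  by apply: leeD; exact: le_lp_normy.
have r0 : 0 < r by rewrite (lt_le_trans ltr01).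
have [g [_ gE]] := @esum_enum R _ (@countable_grid R m X0 dx).
set W := \prod_i dx i 0.
have W0 : 0 < W := step_volume_gt0.
(* The factor [W ^ (1/r)] absorbs the cell volume: [emb] is an isometry into the sequence space of
   the counting measure, where Minkowski's inequality is available. *)
pose emb phi (n : nat) := oapp (fun x => phi x * W `^ r^-1) 0 (g n).
have embE (ph : grid X0 dx -> R) :
    lp_norm r%:E ph = Lnorm (@counting nat R) r%:E (EFin \o emb ph).
  rewrite Lnorm_counting// /lp_norm gE; last first.
    by move=> x; rewrite lee_fin mulr_ge0 ?powR_ge0 ?ltW.
  congr (_ `^ _)%E; apply: eq_eseriesr => n _; rewrite /emb /=.
  case: (g n) => [x|] /=; last by rewrite normr0 powR0// gt_eqF.
  rewrite normrM (ger0_norm (powR_ge0 W _)) powRM ?powR_ge0//.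
  by rewrite -powRrM mulVf ?gt_eqF// powRr1// ltW.
rewrite !embE.
rewrite (_ : EFin \o emb _ = EFin \o (emb phi \+ emb psi)%R); last first.
  apply/funext => n; rewrite /emb /=; case: (g n) => [x|] /=; last by rewrite addr0.
  by rewrite mulrDl.
exact: eminkowski.
Qed.

Lemma measurable_lp_norm d (T : measurableType d) p (a : grid X0 dx -> T -> R) :
  (1 <= p)%E -> (forall x, measurable_fun setT (a x)) ->
  measurable_fun setT (fun w => lp_norm p (fun x => a x w)).
Proof.
have [g [gS gE]] := @esum_enum R _ (@countable_grid R m X0 dx).
case: p => [r| |]//; rewrite ?lee_fin => p1 ma; last first.
  (* A countable supremum of measurable functions; the default value 0 at [None] is harmless since
     the norm is nonnegative. *)
  rewrite (_ : (fun _ => _) = (fun w =>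
      esups (fun n => (oapp (fun x => `|a x w|) 0 (g n))%:E) 0)).
    apply: measurable_fun_esups => n; apply/measurable_EFinP.
    by case: (g n) => [x|] /=; [exact: measurableT_comp | exact: measurable_cst].
  apply/funext => w; apply/eqP; rewrite eq_le; apply/andP; split.
    apply: ge_ereal_sup => _ [x _ <-]; have [n gn] := gS x.
    by apply: ereal_sup_ubound; exists n => //=; rewrite gn.
  apply: ge_ereal_sup => _ [n _ <-]; case: (g n) => [x|] /=.
    exact: le_lp_normy (a^~ w) x.
  exact: lp_norm_ge0 +oo%E (a^~ w).
have r0 : 0 < r by rewrite (lt_le_trans ltr01).
rewrite /lp_norm; apply: (measurableT_comp (measurable_poweR _)).
have W0 : 0 < \prod_i dx i 0 := step_volume_gt0.
under eq_fun.
  move=> w; rewrite gE; last first.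
    by move=> x; rewrite lee_fin mulr_ge0 ?powR_ge0 ?ltW.
  over.
apply: ge0_emeasurable_sum => [n w _ _|n _].
  by case: (g n) => [x|]//=; rewrite lee_fin mulr_ge0 ?powR_ge0 ?ltW.
case: (g n) => [x|] /=; last exact: measurable_cst.
apply/measurable_EFinP; apply: measurable_funM => //.
by apply: (measurableT_comp (measurable_powR r)); exact: measurableT_comp.
Qed.

End lp_norm_theory.

(** The operator norm is a supremum over the unit ball, so [phi] has to be rescaled into it.
    Dividing by slightly more than the norm of [phi] also covers the case of norm 0. *)
Lemma lp_opnorm_le (R : realType) (m : nat) (X0 dx : 'cV[R]_m) (p : \bar R)
    (Gam : (grid X0 dx -> R) -> grid X0 dx -> R) (K : R) (phi : grid X0 dx -> R) :
  positive_step dx -> (1 <= p)%E -> 0 <= K -> lp_operator p Gam ->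
  (lp_opnorm p Gam <= K%:E)%E -> in_lp p phi ->
  (lp_norm p (Gam phi) <= K%:E * lp_norm p phi)%E.
Proof.
move=> dx0 p1 K0 [_ lin] opK phi_lp.
have in0 : in_lp p (fun _ : grid X0 dx => 0) by rewrite /in_lp lp_norm0// ltry.
have Gam0 x : Gam (fun=> 0) x = 0.
  have /(congr1 (@^~ x)) /= := lin 1 _ _ in0 in0.
  rewrite (_ : (fun _ => _) = (fun _ : grid X0 dx => 0)); last first.
    by apply/funext => z; rewrite mulr0 addr0.
  by rewrite mul1r => /eqP; rewrite -subr_eq0 opprD addNKr oppr_eq0 => /eqP.
move: (phi_lp); rewrite /in_lp -ge0_fin_numE ?lp_norm_ge0// => /fineK nE.
set n := fine _ in nE.
have n0 : 0 <= n by rewrite -lee_fin nE lp_norm_ge0.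
rewrite -nE -EFinM; apply/lee_addgt0Pr => e e0.
(* Chosen so that [s * K <= K * n + e]; the [+ 1] keeps the denominator positive when [K = 0]. *)
pose s := n + e / (K + 1).
have K10 : 0 < K + 1 by rewrite ltr_wpDl.
have s0 : 0 < s by rewrite ltr_wpDl// divr_gt0.
pose psi x := s^-1 * phi x.
have psiN : lp_norm p psi = (s^-1 * n)%:E.
  by rewrite lp_normZ ?invr_gt0// -nE.
have psi1 : (lp_norm p psi <= 1)%E.
  by rewrite psiN lee_fin mulrC ler_pdivrMr// mul1r lerDl divr_ge0// ltW.
have psi_lp : in_lp p psi by rewrite /in_lp psiN ltry.
have GE : Gam phi = (fun x => s * Gam psi x).
  rewrite -[in LHS](_ : (fun x => s * psi x + 0) = phi); last first.
    by apply/funext => x; rewrite addr0 /psi mulrA mulfV ?mul1r// gt_eqF.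
  by rewrite (lin s psi (fun=> 0))//; apply/funext => x; rewrite Gam0 addr0.
rewrite GE lp_normZ//.
have h : (lp_norm p (Gam psi) <= K%:E)%E.
  by apply: le_trans opK; apply: ereal_sup_ubound; exists psi.
apply: (@le_trans _ _ (s%:E * K%:E)%E); first by rewrite lee_pmul2l// lte_fin.
have eK : e / (K + 1) * K <= e.
  by rewrite mulrAC ler_pdivrMr// ler_pM2l// lerDl.
by rewrite -EFinM -EFinD lee_fin /s mulrDl [K * n]mulrC lerD2l.
Qed.

(** * The norms [Lnorm] of functions with extended real values *)

Lemma ge0_le_poweR (R : realType) (r : R) (x y : \bar R) :
  0 <= r -> (0 <= x)%E -> (x <= y)%E -> (x `^ r <= y `^ r)%E.
Proof.
move=> r0 x0 xy; apply: gt0_ler_poweR => //; rewrite in_itv/= leey andbT//.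
exact: le_trans xy.
Qed.

Lemma Lnorm_le_ae d (T : measurableType d) (R : realType)
    (mu : {measure set T -> \bar R}) (p : \bar R) (f g : T -> \bar R) :
  (1 <= p)%E -> measurable_fun setT f -> measurable_fun setT g ->
  (forall w, (0 <= f w)%E) -> (forall w, (0 <= g w)%E) ->
  {ae mu, forall w, (f w <= g w)%E} -> (Lnorm mu p f <= Lnorm mu p g)%E.
Proof.
case: p => [r| |]// p1 mf mg f0 g0 fg; rewrite unlock /=; last first.
  case: ifPn => // _; apply: le_ess_sup; apply: filterS fg => w /=.
  by rewrite !gee0_abs.
have r0 : 0 < r by rewrite (lt_le_trans ltr01).
have mp (h : T -> \bar R) : measurable_fun setT h ->
    measurable_fun setT (fun w => (`|h w| `^ r)%E).
  by move=> mh; apply: (measurableT_comp (measurable_poweR _)); exact: measurableT_comp.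
apply: ge0_le_poweR; first by rewrite invr_ge0 ltW.
  by apply: integral_ge0 => w _; exact: poweR_ge0.
apply: ae_ge0_le_integral => //; try exact: mp; try by move=> w _; exact: poweR_ge0.
apply: filterS fg => w fgw _; rewrite !gee0_abs//.
by apply: ge0_le_poweR => //; exact: ltW.
Qed.

Lemma Lnorm_lty_ae d (T : measurableType d) (R : realType)
    (mu : {measure set T -> \bar R}) (p : \bar R) (f : T -> \bar R) :
  (1 <= p)%E -> (0 < mu setT)%E -> measurable_fun setT f ->
  (Lnorm mu p f < +oo)%E ->
  {ae mu, forall w, `|f w| < +oo}%E.
Proof.
case: p => [r| |]// p1 mu0 mf; rewrite unlock /=; last first.
  rewrite mu0 => fy; have := ess_sup_ge mu (abse \o f).
  by apply: filterS => w /= /le_lt_trans; apply.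
have r0 : 0 < r by rewrite (lt_le_trans ltr01).
move=> fy.
have Ify : (\int[mu]_x `|f x| `^ r < +oo)%E.
  rewrite ltey; apply/eqP => Iy; move: fy.
  by rewrite Iy poweRyr ?ltxx// invr_eq0 gt_eqF.
have mfr : measurable_fun setT (fun w => (`|f w| `^ r)%E).
  by apply: (measurableT_comp (measurable_poweR _)); exact: measurableT_comp.
have : mu.-integrable setT (fun w => (`|f w| `^ r)%E).
  apply/integrableP; split => //.
  rewrite (eq_integral (fun w => (`|f w| `^ r)%E))// => w _.
  by rewrite gee0_abs// poweR_ge0.
move=> /(integrable_ae measurableT); apply: filterS => w /(_ I).
by case: (f w) => [x| |] //=; rewrite ?ltry// gt_eqF.
Qed.

(** Reduces to Minkowski's inequality for real functions: if either norm is infinite there is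
    nothing to prove, and otherwise [f] and [g] are finite almost everywhere and can be replaced by
    their finite parts. *)
Lemma Lnorm_triangle d (T : measurableType d) (R : realType)
    (mu : {measure set T -> \bar R}) (p : \bar R) (f g : T -> \bar R) :
  (1 <= p)%E -> (0 < mu setT)%E ->
  measurable_fun setT f -> measurable_fun setT g ->
  (forall w, (0 <= f w)%E) -> (forall w, (0 <= g w)%E) ->
  (Lnorm mu p (fun w => f w + g w) <= Lnorm mu p f + Lnorm mu p g)%E.
Proof.
move=> p1 mu0 mf mg f0 g0.
have [fy|fy] := eqVneq (Lnorm mu p f) +oo%E.
  by rewrite fy addye ?leey// -ltNye (lt_le_trans _ (Lnorm_ge0 _ _ _)).
have [gy|gy] := eqVneq (Lnorm mu p g) +oo%E.
  by rewrite gy addey ?leey// -ltNye (lt_le_trans _ (Lnorm_ge0 _ _ _)).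
have aef := Lnorm_lty_ae p1 mu0 mf; rewrite -ltey in fy; move: (aef fy) => {}aef.
have aeg := Lnorm_lty_ae p1 mu0 mg; rewrite -ltey in gy; move: (aeg gy) => {}aeg.
have mff : measurable_fun setT (fine \o f) by exact: measurableT_comp.
have mgf : measurable_fun setT (fine \o g) by exact: measurableT_comp.
apply: (@le_trans _ _ (Lnorm mu p (EFin \o ((fine \o f) \+ (fine \o g))%R))).
  apply: Lnorm_le_ae => //.
  - exact: emeasurable_funD.
  - by apply/measurable_EFinP; exact: measurable_funD.
  - by move=> w; rewrite adde_ge0.
  - by move=> w; rewrite lee_fin addr_ge0 ?fine_ge0.
  - apply: filterS2 aef aeg => w; rewrite !gee0_abs// => fw gw.
    by rewrite /= EFinD !fineK ?ge0_fin_numE.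
apply: (le_trans (eminkowski _ _ _ _)) => //.
apply: leeD; apply: Lnorm_le_ae => //; try exact/measurable_EFinP.
- by move=> w; rewrite lee_fin fine_ge0.
- by apply: filterS aef => w; rewrite gee0_abs// => fw; rewrite /= fineK// ge0_fin_numE.
- by move=> w; rewrite lee_fin fine_ge0.
- by apply: filterS aeg => w; rewrite gee0_abs// => fw; rewrite /= fineK// ge0_fin_numE.
Qed.

Lemma Lnorm_prob_cst d (T : measurableType d) (R : realType)
    (P : probability T R) (p : \bar R) (c : \bar R) :
  (1 <= p)%E -> (0 <= c)%E -> Lnorm P p (cst c) = c.
Proof.
have PT : P setT = 1%E by exact: probability_setT.
case: p => [r| |]// p1 c0; rewrite unlock /=; last first.
  rewrite PT lte01; have -> : abse \o cst c = cst c :> (T -> \bar R).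
    by apply/funext => w /=; rewrite gee0_abs.
  by apply: ess_sup_cst; rewrite [X in (0 < X)%E]PT.
have r0 : r != 0 by rewrite gt_eqF// (lt_le_trans ltr01).
under eq_integral do rewrite gee0_abs//.
have -> : (\int[P]_(x in [set: T]) (c `^ r) = c `^ r)%E.
  by rewrite integral_cst// -[RHS]mule1; congr (_ * _)%E.
by rewrite -poweRrM mulfV// poweRe1.
Qed.

(** * The backward recursion *)

(** Here the equality of the inner and outer exponents is used: the outer power cancels the inner
    root, and sum and integral can be exchanged, all terms being nonnegative. *)
Lemma integral_weighted_lp_norm d (T : measurableType d) (R : realType)
    (P : probability T R) (m : nat) (X0 dx : 'cV[R]_m) (r : R)
    (g : nat -> option (grid X0 dx)) (V : T -> R) (c : grid X0 dx -> T -> R) :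
  positive_step dx -> 1 <= r ->
  (forall a : grid X0 dx -> \bar R, (forall x, (0 <= a x)%E) ->
    (\esum_(x in [set: grid X0 dx]) a x = \sum_(n <oo) oapp a 0 (g n))%E) ->
  measurable_fun setT V -> (forall w, 0 < V w) ->
  (forall x, measurable_fun setT (c x)) ->
  (\int[P]_w (`|(V w)%:E * lp_norm r%:E (fun x => c x w)| `^ r) =
   \sum_(n <oo) oapp (fun x => (\prod_i dx i 0)%:E *
      \int[P]_w ((V w * `|c x w|) `^ r)%:E) 0 (g n))%E.
Proof.
move=> dx0 r1 gE mV V0 mc.
have r0 : 0 < r by rewrite (lt_le_trans ltr01).
have W0 := step_volume_gt0 dx0; set W := \prod_i dx i 0 in W0 *.
pose t n w : \bar R := oapp (fun x => (W * (V w * `|c x w|) `^ r)%:E) 0%E (g n).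
have t0 n w : (0 <= t n w)%E.
  rewrite /t; case: (g n) => [x|]//=.
  by rewrite lee_fin mulr_ge0 ?powR_ge0// ltW.
have mVc x : measurable_fun setT (fun w => (V w * `|c x w|) `^ r).
  apply: (measurableT_comp (measurable_powR r)); apply: measurable_funM => //.
  exact: measurableT_comp.
have mt n : measurable_fun setT (t n).
  rewrite /t; case: (g n) => [x|] /=; last exact: measurable_cst.
  by apply/measurable_EFinP; apply: measurable_funM.
transitivity (\int[P]_w \sum_(n <oo) t n w)%E.
  apply: eq_integral => w _.
  rewrite gee0_abs; last first.
    by rewrite mule_ge0 ?lp_norm_ge0// lee_fin ltW.
  rewrite poweRM ?lp_norm_ge0//; last by rewrite lee_fin ltW.
  rewrite poweR_lp_norm//; last by rewrite gt_eqF.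
  rewrite gE; last by move=> x; rewrite lee_fin mulr_ge0 ?powR_ge0// ltW.
  rewrite poweR_EFin -nneseriesZl; last first.
    by move=> n _; case: (g n) => [x|] //=; rewrite lee_fin mulr_ge0 ?powR_ge0// ltW.
  apply: eq_eseriesr => n _; rewrite /t; case: (g n) => [x|] /=; last by rewrite mule0.
  rewrite powRM ?(ltW (V0 w))// -/W.
  have e : V w `^ r * (`|c x w| `^ r * W) = W * (V w `^ r * `|c x w| `^ r).
    by rewrite mulrA mulrC.
  by rewrite -e [RHS]EFinM.
rewrite integral_nneseries//.
apply: eq_eseriesr => n _; rewrite /t; case: (g n) => [x|] /=; last by rewrite integral0.
under eq_integral do rewrite EFinM.
rewrite ge0_integralZl_EFin//; last by rewrite ltW.
- by move=> w _; rewrite lee_fin powR_ge0.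
- exact/measurable_EFinP.
Qed.

Lemma LnormE d (T : measurableType d) (R : realType)
    (mu : {measure set T -> \bar R}) (r : R) (f : T -> \bar R) :
  Lnorm mu r%:E f = ((\int[mu]_x (`|f x| `^ r)) `^ r^-1)%E.
Proof. by rewrite unlock. Qed.

Lemma LnormyE d (T : measurableType d) (R : realType)
    (mu : {measure set T -> \bar R}) (f : T -> \bar R) :
  Lnorm mu +oo f = (if (0 < mu setT)%E then ess_sup mu (abse \o f) else 0%E).
Proof. by rewrite unlock. Qed.

(** The comparison is made at each grid point: by [le_integral_powR] and summation for finite [p],
    and by [ae_le_of_integral_le] for [p = +oo], countably many null sets being discarded. *)
Lemma Lnorm_lp_norm_contraction d (T : measurableType d) (R : realType)
    (P : probability T R) (m : nat) (X0 dx : 'cV[R]_m) (p : \bar R)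
    (F : set (set T)) (V : T -> R) (a b : grid X0 dx -> T -> R) :
  positive_step dx -> (1 <= p)%E -> F `<=` measurable -> F setT ->
  measurable_fun setT V -> (forall w, 0 < V w) ->
  (forall x, sigma1 (fun w => V w * `|a x w|) `<=` F) ->
  (forall x, measurable_fun setT (a x)) ->
  (forall x, measurable_fun setT (b x)) ->
  (forall x A, F A -> (\int[P]_(w in A) (V w * `|a x w|)%:E <=
                       \int[P]_(w in A) (V w * `|b x w|)%:E)%E) ->
  (Lnorm P p (fun w => (V w)%:E * lp_norm p (fun x => a x w)) <=
   Lnorm P p (fun w => (V w)%:E * lp_norm p (fun x => b x w)))%E.
Proof.
move=> dx0 p1 Fm FT mV V0 aF ma mb ab.
have [g [gS gE]] := @esum_enum R _ (@countable_grid R m X0 dx).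
have mVc (c : grid X0 dx -> T -> R) x : (forall x, measurable_fun setT (c x)) ->
    measurable_fun setT (fun w => V w * `|c x w|).
  by move=> mc; apply: measurable_funM => //; exact: measurableT_comp.
have Vc0 (c : grid X0 dx -> T -> R) x w : 0 <= V w * `|c x w|.
  by rewrite mulr_ge0// ltW.
case: p p1 => [r| |]// p1.
  rewrite lee_fin in p1.
  have r0 : 0 < r by rewrite (lt_le_trans ltr01).
  rewrite !LnormE; apply: ge0_le_poweR; first by rewrite invr_ge0 ltW.
    by apply: integral_ge0 => w _; exact: poweR_ge0.
  have /ltW W0 := step_volume_gt0 dx0.
  rewrite (integral_weighted_lp_norm P dx0 p1 gE mV V0 ma).
  rewrite (integral_weighted_lp_norm P dx0 p1 gE mV V0 mb).
  apply: lee_nneseries => n _ => [_|].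
    case: (g n) => [x|]//=; apply: mule_ge0; rewrite ?lee_fin//.
    by apply: integral_ge0 => w _; rewrite lee_fin powR_ge0.
  case: (g n) => [x|]//=; apply: lee_wpmul2l; rewrite ?lee_fin//.
  apply: (le_integral_powR Fm FT (aF x)) => //; [exact: mVc | exact: ab].
rewrite !LnormyE; case: ifPn => // _; set M := (leRHS).
have Vlp0 (c : grid X0 dx -> T -> R) w :
    (0 <= (V w)%:E * lp_norm +oo (fun x => c x w))%E.
  by rewrite mule_ge0 ?lp_norm_ge0// lee_fin ltW.
have bM : {ae P, forall w, ((V w)%:E * lp_norm +oo (fun x => b x w) <= M)%E}.
  apply: filterS (ess_sup_ge P (abse \o (fun w =>
    ((V w)%:E * lp_norm +oo (fun x => b x w))%E))) => w.
  by rewrite [(abse \o _) w]gee0_abs.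
have aM x : {ae P, forall w, ((V w * `|a x w|)%:E <= M)%E}.
  apply: (ae_le_of_integral_le Fm (aF x) (mVc b x mb)) => //.
  - exact: ab.
  - apply: filterS bM => w; apply: le_trans.
    by rewrite EFinM lee_pmul2l ?lte_fin//; exact: (le_lp_normy (b^~ w)).
(* The default value [M] makes the bound trivial at the indices that enumerate no grid point. *)
have aMn : {ae P, forall w, forall n : nat,
    (oapp (fun x => (V w * `|a x w|)%:E) M (g n) <= M)%E}.
  apply/ae_foralln => n; case: (g n) => [x|] /=; first exact: aM.
  exact: nearW.
apply/ess_supP; apply: filterS aMn => w aw.
rewrite [(abse \o _) w]gee0_abs//.
rewrite /lp_norm -ereal_sup_pZl//; apply: ge_ereal_sup => _ [_ [x _ <-] <-].
by have [n gn] := gS x; have := aw n; rewrite gn /= EFinM.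
Qed.

(** Expresses adaptedness as measurability for a generated sigma-algebra, so that the closure rules
    for sums, products and compositions apply to it. *)
Lemma sigma1P d (T : measurableType d) d' (E : measurableType d')
    (GG : set (set T)) (f : T -> E) :
  sigma1 f `<=` <<s GG>> <->
  measurable_fun (setT : set (g_sigma_algebraType GG)) f.
Proof.
split=> [h _ B mB|h _ [B mB <-]]; last exact: h.
by rewrite setTI; apply: h; exists B => //; rewrite setTI.
Qed.

Lemma eq_abs_lp_norm (R : realType) (m : nat) (X0 dx : 'cV[R]_m) (p : \bar R)
    (phi psi : grid X0 dx -> R) :
  (forall x, `|phi x| = `|psi x|) -> lp_norm p phi = lp_norm p psi.
Proof.
move=> e; case: p => [r| |] //=; last by under eq_fun do rewrite e.
by congr (_ `^ _)%E; apply: eq_esum => x _; rewrite e.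
Qed.

(** One step of the recursion on the norms of the error. [err + rem] stands for the conditional
    expectation of [Z], the operator applied to the next error; only its consequence on integrals of
    absolute values is used. Stability enters through the last hypothesis. *)
Lemma backward_step d (T : measurableType d) (R : realType)
    (P : probability T R) (m : nat) (X0 dx : 'cV[R]_m) (p : \bar R)
    (GG : set (set T)) (V V' : T -> R) (err err' rem Z : grid X0 dx -> T -> R) :
  positive_step dx -> (1 <= p)%E -> <<s GG>> `<=` measurable ->
  sigma1 V `<=` <<s GG>> -> (forall w, 0 < V w) ->
  measurable_fun setT V' -> (forall w, 0 < V' w) ->
  (forall x, sigma1 (err x) `<=` <<s GG>>) ->
  (forall x, sigma1 (rem x) `<=` <<s GG>>) ->
  (forall x, measurable_fun setT (err' x)) ->
  (forall x, measurable_fun setT (Z x)) ->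
  (forall x A, <<s GG>> A -> (\int[P]_(w in A) (`|err x w + rem x w|)%:E <=
                       \int[P]_(w in A) (`|Z x w|)%:E)%E) ->
  {ae P, forall w, ((V w)%:E * lp_norm p (fun x => Z x w) <=
                    (V' w)%:E * lp_norm p (fun x => err' x w))%E} ->
  (Lnorm P p (fun w => (V w)%:E * lp_norm p (fun x => err x w)) <=
   Lnorm P p (fun w => (V' w)%:E * lp_norm p (fun x => err' x w)) +
   Lnorm P p (fun w => (V w)%:E * lp_norm p (fun x => rem x w)))%E.
Proof.
move=> dx0 p1 Fm FV V0 mV' V'0 Ferr Frem merr' mZ condexp ZV.
have FT : <<s GG>> setT.
  exact: (@measurableT _ (g_sigma_algebraType GG)).
have mV : measurable_fun setT V by exact: sigma1_measurable FV.
have merr x : measurable_fun setT (err x) by exact: sigma1_measurable (Ferr x).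
have mrem x : measurable_fun setT (rem x) by exact: sigma1_measurable (Frem x).
pose xi x w := err x w + rem x w.
have mxi x : measurable_fun setT (xi x) by exact: measurable_funD.
have mVlp (U : T -> R) (c : grid X0 dx -> T -> R) : measurable_fun setT U ->
    (forall x, measurable_fun setT (c x)) ->
    measurable_fun setT (fun w => (U w)%:E * lp_norm p (fun x => c x w))%E.
  move=> mU mc; apply: emeasurable_funM; first exact/measurable_EFinP.
  exact: measurable_lp_norm.
have Vlp0 (U : T -> R) (c : grid X0 dx -> T -> R) w : (0 < U w) ->
    (0 <= (U w)%:E * lp_norm p (fun x => c x w))%E.
  by move=> U0; rewrite mule_ge0 ?lp_norm_ge0// lee_fin ltW.
have PT : (0 < P setT)%E by rewrite probability_setT.
apply: (@le_trans _ _ (Lnorm P p (fun w => (V w)%:E * lp_norm p (fun x => xi x w)) +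
   Lnorm P p (fun w => (V w)%:E * lp_norm p (fun x => rem x w)))%E).
  apply: le_trans (Lnorm_triangle p1 PT _ _ _ _) => //;
    try exact: mVlp; try (by move=> w; apply: Vlp0).
  apply: Lnorm_le_ae => //; try exact: mVlp; try (by move=> w; apply: Vlp0).
  - by apply: emeasurable_funD; apply: mVlp.
  - by move=> w; rewrite adde_ge0 ?Vlp0.
  apply: nearW => w; rewrite -ge0_muleDr ?lp_norm_ge0// lee_pmul2l ?lte_fin//.
  (* The error is recovered as [xi - rem], and the triangle inequality is applied first on the grid,
     then on the probability space. *)
  rewrite [leLHS](@eq_abs_lp_norm _ _ _ _ _ _ (fun x => xi x w + - rem x w)); last first.
    by move=> x; rewrite addrK.
  apply: le_trans (lp_normD dx0 _ _ p1) _; apply: leeD => //.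
  by rewrite (@eq_abs_lp_norm _ _ _ _ _ _ (fun x => rem x w))// => x; rewrite normrN.
apply: leeD => //.
apply: (@le_trans _ _ (Lnorm P p (fun w => (V w)%:E * lp_norm p (fun x => Z x w)))%E).
  apply: (Lnorm_lp_norm_contraction dx0 p1 Fm FT mV V0) => //.
    move=> x; apply/sigma1P; apply: measurable_funM; first exact/sigma1P.
    apply: measurableT_comp => //; apply: measurable_funD; exact/sigma1P.
  move=> x A FA; rewrite [leLHS]integral_setE [leRHS]integral_setE.
  under eq_integral do rewrite mulrA.
  under [leRHS]eq_integral do rewrite mulrA.
  (* [V] is measurable with respect to the past, so it joins [1_A] in the weight and the unweighted
     inequality suffices. *)
  apply: (@le_integral_weight _ _ _ P _ (fun w => \1_A w * V w) _ _ Fm) => //.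
  - apply/sigma1P; apply: measurable_funM; last exact/sigma1P.
    exact: measurable_indic.
  - by move=> w; apply: mulr_ge0; [rewrite indicE ler0n | exact: ltW].
  - exact: measurableT_comp.
  - exact: measurableT_comp.
  - exact: condexp.
apply: Lnorm_le_ae => //; try exact: mVlp; by move=> w; apply: Vlp0.
Qed.

(** * The past of the chain and conditioning on it *)

Lemma sigma_family_sub_measurable d (T : measurableType d) d' (E : measurableType d')
    (I : Type) (D : set I) (Z : I -> T -> E) :
  (forall i, D i -> measurable_fun setT (Z i)) -> sigma_family D Z `<=` measurable.
Proof.
move=> mZ; apply: smallest_sub; first exact: sigma_algebra_measurable.
by move=> _ [i Di [B mB <-]]; exact: mZ.
Qed.

Lemma sigma1_sub_family d (T : measurableType d) d' (E : measurableType d')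
    (I : Type) (D : set I) (Z : I -> T -> E) i :
  D i -> sigma1 (Z i) `<=` sigma_family D Z.
Proof. by move=> Di A ZA; apply: sub_sigma_algebra; exists i. Qed.

Lemma sigma_family_setI d (T : measurableType d) d' (E : measurableType d')
    (I : Type) (D : set I) (Z : I -> T -> E) : setI_closed (sigma_family D Z).
Proof.
move=> A B FA FB.
exact: (@measurableI _ (g_sigma_algebraType (\bigcup_(i in D) sigma1 (Z i)))).
Qed.

(** The inequality [|E[Z | F]| <= E[|Z| | F]]. Since [xi] is [F]-measurable, [A] splits inside [F]
    according to the sign of [xi], and on each piece the integral of [|xi|] is, up to sign, that of
    [Z]. *)
Lemma integral_norm_le_of_integral_eq d (T : measurableType d) (R : realType)
    (P : probability T R) (F : set (set T)) (xi Z : T -> R) (A : set T) :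
  F `<=` measurable -> setI_closed F -> sigma1 xi `<=` F ->
  measurable_fun setT Z ->
  (forall A', F A' ->
     (\int[P]_(w in A') (Z w)%:E = \int[P]_(w in A') (xi w)%:E)%E) ->
  F A ->
  (\int[P]_(w in A) `|xi w|%:E <= \int[P]_(w in A) `|Z w|%:E)%E.
Proof.
move=> Fm FI xiF mZ Zxi FA.
have mxi : measurable_fun setT xi by exact: sigma1_measurable xiF.
pose U := xi @^-1` `[0, +oo[.
pose N := xi @^-1` `]-oo, 0[.
have FU : F (A `&` U).
  by apply: FI => //; apply: xiF; exists `[0, +oo[%classic => //; rewrite setTI.
have FN : F (A `&` N).
  by apply: FI => //; apply: xiF; exists `]-oo, 0[%classic => //; rewrite setTI.
have UN : A = (A `&` U) `|` (A `&` N).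
  rewrite -setIUr (_ : U `|` N = setT) ?setIT//.
  apply/seteqP; split => // w _; rewrite /U /N /= !in_itv/= andbT.
  by case: (leP 0 (xi w)); [left | right].
have dUN : [disjoint A `&` U & A `&` N].
  apply/disj_setPS => w [[_ Uw] [_ Nw]].
  by move: Uw Nw; rewrite /U /N /= !in_itv/= andbT ltNge => ->.
have spl (k : T -> R) : measurable_fun setT k ->
    (\int[P]_(w in A) `|k w|%:E = \int[P]_(w in A `&` U) `|k w|%:E +
      \int[P]_(w in A `&` N) `|k w|%:E)%E.
  move=> mk; rewrite {1}UN ge0_integral_setU//; try exact: Fm.
  by apply: measurable_funTS; apply/measurable_EFinP; exact: measurableT_comp.
have absint B : F B -> (`|\int[P]_(w in B) (xi w)%:E| <= \int[P]_(w in B) `|Z w|%:E)%E.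
  move=> FB; rewrite -Zxi//; apply: (le_trans (le_abse_integral _ _ _)) => //.
    exact: Fm.
  by apply: measurable_funTS; exact/measurable_EFinP.
rewrite (spl _ mxi) (spl _ mZ); apply: leeD.
  apply: le_trans (absint _ FU).
  rewrite (eq_integral (fun w => (xi w)%:E)); first exact: lee_abs.
  move=> w /set_mem[_]; rewrite /U /= in_itv/= andbT => xi0.
  by rewrite ger0_norm.
apply: le_trans (absint _ FN).
rewrite (eq_integral (fun w => - (xi w)%:E)%E); last first.
  by move=> w /set_mem[_]; rewrite /N /= in_itv/= => xi0; rewrite ltr0_norm.
have -> : (\int[P]_(w in A `&` N) (xi w)%:E =
    - \int[P]_(w in A `&` N) (- (xi w)%:E))%E.
  rewrite -integral_ge0N => [|w [_]]; last first.
    by rewrite /N /= in_itv/= => xi0; rewrite lee_fin oppr_ge0 ltW.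
  by apply: eq_integral => w _; rewrite oppeK.
by rewrite abseN lee_abs.
Qed.

Lemma sigma1_pair_comp_on d (T : measurableType d) d' (E : measurableType d')
    d'' (E' : measurableType d'') (R : realType) (Y : T -> E) (Y' : T -> E')
    (S : set E) (S' : set E') (f : E * E' -> R) :
  measurable S -> measurable S' -> (forall w, S (Y w)) -> (forall w, S' (Y' w)) ->
  measurable_fun (S `*` S') f ->
  sigma1 (fun w => f (Y w, Y' w)) `<=` sigma1 (fun w => (Y w, Y' w)).
Proof.
move=> mS mS' SY SY' mf.
apply: (@sigma1_comp_on _ T _ (E * E')%type _ _ (fun w => (Y w, Y' w)) (S `*` S') f) => //.
- exact: measurableX.
- by move=> w; split; [exact: SY | exact: SY'].
Qed.

(** The scheme and the consistency condition only condition on the present [Y n]; the Markov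
    property carries the resulting bound over to the whole past, where the weights of the recursion
    are measurable. *)
Lemma markov_condexp_norm_le d (T : measurableType d) (R : realType)
    (P : probability T R) d' (E : measurableType d') (N n : nat)
    (S : nat -> set E) (Y : nat -> T -> E)
    (Psi1 Psi2 : E -> E -> R) (g1 g2 : E -> R) (A : set T) :
  markov_chain P N S Y -> (n < N)%N ->
  is_cond_exp_at P (S n) (S n.+1) (Y n) (Y n.+1) Psi1 g1 ->
  is_cond_exp_at P (S n) (S n.+1) (Y n) (Y n.+1) Psi2 g2 ->
  sigma_family [set k | (k <= n)%N] Y A ->
  (\int[P]_(w in A) (`|g1 (Y n w) - g2 (Y n w)|)%:E <=
   \int[P]_(w in A) (`|Psi1 (Y n w) (Y n.+1 w) - Psi2 (Y n w) (Y n.+1 w)|)%:E)%E.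
Proof.
move=> [mS mY SY markov] nN [mPsi1 mg1 ce1] [mPsi2 mg2 ce2] FA.
have nN' := ltnW nN.
have mYn : measurable_fun setT (Y n) by exact: mY.
have sYm := sigma1_sub_measurable mYn.
have YF : sigma1 (Y n) `<=` sigma_family [set k | (k <= n)%N] Y.
  by apply: sigma1_sub_family => /=.
have Fm : sigma_family [set k | (k <= n)%N] Y `<=` measurable.
  by apply: sigma_family_sub_measurable => k /= kn; apply: mY; exact: leq_trans kn nN'.
have mg : measurable_fun (S n) (g1 \- g2) by exact: measurable_funB.
have gY : sigma1 ((g1 \- g2) \o Y n) `<=` sigma1 (Y n).
  by apply: sigma1_comp_on (mS _ nN') _ mg => w; exact: SY.
have [iPsi1 ig1 _ e1] := ce1.
have [iPsi2 ig2 _ e2] := ce2.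
pose Z w := Psi1 (Y n w) (Y n.+1 w) - Psi2 (Y n w) (Y n.+1 w).
have mZ : measurable_fun setT Z.
  by apply: measurable_funB; apply/measurable_EFinP;
    [exact: measurable_int iPsi1 | exact: measurable_int iPsi2].
apply: (markov_integral_le Fm YF _ (mY _ nN) _ _ _ _ _ _ FA
  (xi := fun w => `|g1 (Y n w) - g2 (Y n w)|) (Z := fun w => `|Z w|)) => //.
- exact: sigma_family_setI.
- move=> B mB; have [g [mgB [_ _ _ gE]]] := markov n B nN mB.
  (* The transition function is measurable on the state space only; extending it by 0 makes it
     measurable everywhere without changing it along the chain. *)
  exists (g \_ (S n)); split; first exact/(measurable_restrictT _ (mS _ nN')).
  move=> A' FA'; rewrite gE//; apply: eq_integral => w _.
  by rewrite /= patchE mem_set//; exact: SY.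
- apply: (@sigma1_comp_on _ _ _ _ _ _ (Y n) (S n) (fun y => `|g1 y - g2 y|)).
  + exact: mS.
  + by move=> w; exact: SY.
  + exact: measurableT_comp.
- apply: (@sigma1_pair_comp_on _ _ _ _ _ _ _ (Y n) (Y n.+1) (S n) (S n.+1)
    (fun z => `|Psi1 z.1 z.2 - Psi2 z.1 z.2|)).
  + exact: mS.
  + exact: mS.
  + by move=> w; exact: SY.
  + by move=> w; exact: SY.
  + by apply: measurableT_comp => //; exact: measurable_funB.
move=> A' YA'.
apply: (@integral_norm_le_of_integral_eq _ _ _ P (sigma1 (Y n)) ((g1 \- g2) \o Y n) Z) => //.
  move=> _ _ [B mB <-] [C mC <-]; exists (B `&` C); first exact: measurableI.
  by rewrite !setTI.
move=> B YB; have mB : measurable B by exact: sYm.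
transitivity (\int[P]_(w in B) ((Psi1 (Y n w) (Y n.+1 w))%:E - (Psi2 (Y n w) (Y n.+1 w))%:E))%E.
  by apply: eq_integral => w _; rewrite EFinB.
rewrite integralB//; [|exact: (integrableS measurableT mB _ iPsi1)
  |exact: (integrableS measurableT mB _ iPsi2)].
rewrite e1// e2//.
transitivity (\int[P]_(w in B) ((g1 (Y n w))%:E - (g2 (Y n w))%:E))%E.
  by rewrite integralB//; [exact: (integrableS measurableT mB _ ig1) |
    exact: (integrableS measurableT mB _ ig2)].
by apply: eq_integral => w _; rewrite /= EFinB.
Qed.

Lemma Lnorm_pZl d (T : measurableType d) (R : realType)
    (mu : {measure set T -> \bar R}) (p : \bar R) (K : R) (f : T -> \bar R) :
  (1 <= p)%E -> 0 < K -> measurable_fun setT f -> (forall w, (0 <= f w)%E) ->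
  Lnorm mu p (fun w => K%:E * f w)%E = (K%:E * Lnorm mu p f)%E.
Proof.
move=> p1 K0 mf f0; have K0' := ltW K0.
have Kf0 w : (0 <= K%:E * f w)%E by rewrite mule_ge0 ?lee_fin.
case: p p1 => [r| |]// p1; last first.
  rewrite !LnormyE; case: ifPn; last by rewrite mule0.
  rewrite -ess_sup_pZl// => _; congr (ess_sup _ _); apply/funext => w /=.
  by rewrite abseM gee0_abs ?lee_fin.
have r0 : 0 < r by rewrite (lt_le_trans ltr01).
rewrite !LnormE.
transitivity ((\int[mu]_x ((K `^ r)%:E * `|f x| `^ r)) `^ r^-1)%E.
  congr (_ `^ _)%E; apply: eq_integral => w _.
  by rewrite abseM gee0_abs ?lee_fin// poweRM ?lee_fin.
rewrite ge0_integralZl_EFin ?powR_ge0//; last 2 first.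
- by move=> w _; exact: poweR_ge0.
- by apply: (measurableT_comp (measurable_poweR _)); exact: measurableT_comp.
rewrite poweRM ?lee_fin ?powR_ge0//; last first.
  by apply: integral_ge0 => w _; exact: poweR_ge0.
by rewrite poweR_EFin -powRrM mulfV ?gt_eqF// powRr1.
Qed.

Lemma measurable_open_or_closure (R : realType) (d : nat) (Dom D : set 'cV[R]_d) :
  open Dom -> D = Dom \/ D = closure Dom -> measurable D.
Proof.
have mo (U : set 'cV[R]_d) : open U -> measurable U.
  by move=> oU; apply: sub_sigma_algebra.
move=> oDom [->|->]; first exact: mo.
rewrite -[X in measurable X]setCK; apply: measurableC; apply: mo.
by apply: closed_openC; exact: closed_closure.
Qed.

(** The hypotheses match what the recursion knows: [u] is in l_p by assumption and the error is by
    induction. Writing [psi = - (phi - psi) + phi] puts linearity in terms of these two. *)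
Lemma lp_operatorB (R : realType) (m : nat) (X0 dx : 'cV[R]_m) (p : \bar R)
    (Gam : (grid X0 dx -> R) -> grid X0 dx -> R) (phi psi : grid X0 dx -> R) x :
  lp_operator p Gam -> in_lp p phi -> in_lp p (fun x => phi x - psi x) ->
  Gam (fun x => phi x - psi x) x = Gam phi x - Gam psi x.
Proof.
move=> [_ lin] hphi hd.
have := lin (-1) _ _ hd hphi.
rewrite (_ : (fun _ => _) = psi); last first.
  by apply/funext => z; rewrite mulN1r opprB subrK.
by move=> /(congr1 (@^~ x)) /= ->; rewrite mulN1r opprD opprK addrCA subrr addr0.
Qed.

(** * The error estimate *)

Unset Implicit Arguments.

Theorem theorem4p1 (R : realType) (m d l1 l l2 : nat)
  (Dom D : set 'cV[R]_d)
  (hDom : [/\ open Dom, convex_set (Dom : set (convex_lmodType 'cV[R]_d))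
            & Dom !=set0])
  (hD : D = Dom \/ D = closure Dom)
  (T : R) (hT : 0 < T)
  (co : coefficients R m d l1 l l2)
  (hJ : exists pJ, has_density (jump_law co) pJ)
  (X0 : 'cV[R]_m) (Y0 : 'cV[R]_d) (hY0 : D Y0)
  (f : 'cV[R]_m -> 'cV[R]_d -> R)
  (u : R -> 'cV[R]_m -> 'cV[R]_d -> R)
  (hwp : weakly_well_posed co D T)
  (hu : is_value_function co D T f u)
  (hpide : solves_pide co D T f u)
  (S0 : jump_system R m d l1 l l2)
  (hS0 : weak_solution co T 0 X0 Y0 S0) (hS0D : lives_in D T 0 S0)
  (* the index N stands for h = T / N *)
  (Ysp : nat -> nat -> set 'cV[R]_d)
  (Yh : nat -> nat -> Omega S0 -> 'cV[R]_d)
  (hYsp : forall N n, (0 < N)%N -> (n <= N)%N -> Ysp N n `<=` D)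
  (hYh0 : forall N w, (0 < N)%N -> Yh N 0%N w = Y0)
  (hYh : forall N, (0 < N)%N -> markov_chain (Pr S0) N (Ysp N) (Yh N))
  (hYhind : forall N, (0 < N)%N ->
     independent2 (Pr S0) (sigma_family [set n | (n <= N)%N] (Yh N))
       <<s sigma_family (@nonneg_times R) (BB S0) `|`
           sigma_family (@nonneg_times R) (HH S0) >>)
  (p : \bar R) (hp : (1%:E <= p)%E)
  (hul : forall N n (dx : 'cV[R]_m) y, (0 < N)%N -> (n <= N)%N ->
     positive_step dx -> Ysp N n y ->
     in_lp p (fun x : grid X0 dx => u (n%:R * (T / N%:R)) (val x) y))
  (c : 'cV[R]_d -> R) (hc0 : forall y, D y -> 0 <= c y)
  (hcm : measurable_fun D c)
  (E : R -> 'cV[R]_m -> R)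
  (hE0 : forall N (dx : 'cV[R]_m), (0 < N)%N -> positive_step dx ->
     0 <= E (T / N%:R) dx)
  (hElim : (fun q : R * 'cV[R]_m => E q.1 q.2)
     @ within (admissible T) (nbhs (0 : R, 0 : 'cV[R]_m)) --> (0 : R))
  (Pi : forall (N : nat) (dx : 'cV[R]_m), 'cV[R]_d ->
     (grid X0 dx -> R) -> (grid X0 dx -> R))
  (hPi : forall N (dx : 'cV[R]_m) y, (0 < N)%N -> positive_step dx -> D y ->
     lp_operator p (Pi N dx y))
  (uh : nat -> forall dx : 'cV[R]_m, nat -> grid X0 dx -> 'cV[R]_d -> R)
  (huhN : forall N (dx : 'cV[R]_m) x y, (0 < N)%N -> positive_step dx ->
     Ysp N N y -> uh N dx N x y = f (val x) y)
  (huh : forall N (dx : 'cV[R]_m) n x, (0 < N)%N -> positive_step dx ->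
     (n < N)%N ->
     is_cond_exp_at (Pr S0) (Ysp N n) (Ysp N n.+1) (Yh N n) (Yh N n.+1)
       (fun y y' => Pi N dx y (fun x' => uh N dx n.+1 x' y') x)
       (fun y => uh N dx n x y))
  (hstab : forall N (dx : 'cV[R]_m) y, (0 < N)%N -> positive_step dx -> D y ->
     (lp_opnorm p (Pi N dx y) <= (1 + c y * (T / N%:R))%:E)%E)
  (Rem : nat -> forall dx : 'cV[R]_m, nat -> grid X0 dx -> 'cV[R]_d -> R)
  (hRemm : forall N (dx : 'cV[R]_m) n x, (0 < N)%N -> positive_step dx ->
     (n < N)%N -> measurable_fun (Ysp N n) (Rem N dx n x))
  (hcons : forall N (dx : 'cV[R]_m) n x, (0 < N)%N -> positive_step dx ->
     (n < N)%N ->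
     is_cond_exp_at (Pr S0) (Ysp N n) (Ysp N n.+1) (Yh N n) (Yh N n.+1)
       (fun y y' =>
          Pi N dx y (fun x' => u (n.+1%:R * (T / N%:R)) (val x') y') x)
       (fun y => u (n%:R * (T / N%:R)) (val x) y + Rem N dx n x y))
  (hrem : exists hbar C : R, [/\ 0 < hbar, 0 < C &
     forall N (dx : 'cV[R]_m) n, (0 < N)%N -> T / N%:R < hbar ->
       positive_step dx -> small_step dx -> (n < N)%N ->
       (Lnorm (Pr S0) p (fun w =>
          (expR (\sum_(1 <= k < n.+1) c (Yh N k w) * (T / N%:R)))%:E
          * lp_norm p (fun x => Rem N dx n x (Yh N n w)))
        <= (C * (T / N%:R) * E (T / N%:R) dx)%:E)%E]) :
  exists hbar C : R, [/\ 0 < hbar, 0 < C &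
    forall N (dx : 'cV[R]_m), (0 < N)%N -> T / N%:R < hbar ->
      positive_step dx -> small_step dx ->
      (lp_norm p (fun x : grid X0 dx =>
         (u 0 (val x) Y0 - uh N dx 0%N x Y0)%R)
       <= (C * T * E (T / N%:R) dx)%:E)%E].
Proof.
have [hbar [C [hbar0 C0 hR]]] := hrem.
pose K := expR (c Y0 * T).
have K0 : 0 < K by exact: expR_gt0.
exists hbar, (C * K); split => //; first exact: mulr_gt0.
move=> N dx N0 hN dx0 dx1.
set h := T / N%:R in hN *.
have NR0 : (0 : R) < N%:R by rewrite ltr0n.
have h0 : 0 < h by rewrite divr_gt0.
have Nh : N%:R * h = T by rewrite /h mulrCA mulfV ?mulr1// gt_eqF.
have hT' : h <= T by rewrite /h ler_pdivrMr// ler_peMr ?ler1n// ltW.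
have E0 := hE0 N dx N0 dx0; rewrite -/h in E0.
have chain := hYh N N0.
have [mS mY SY _] := chain.
have oDom : open Dom by case: hDom.
have mD : measurable D := measurable_open_or_closure oDom hD.
have YD n w : (n <= N)%N -> D (Yh N n w).
  by move=> nN; apply: (hYsp N n N0 nN); exact: SY.
pose FF n := sigma_family [set k | (k <= n)%N] (Yh N).
have FFm n : (n <= N)%N -> FF n `<=` measurable.
  move=> nN; apply: sigma_family_sub_measurable => k /= kn.
  by apply: mY; exact: leq_trans kn nN.
have YF k n : (k <= n)%N -> sigma1 (Yh N k) `<=` FF n.
  by move=> kn; exact: sigma1_sub_family.
have comp_FF k n (phi : 'cV[R]_d -> R) : (k <= n)%N -> (k <= N)%N ->
    measurable_fun (Ysp N k) phi -> sigma1 (phi \o Yh N k) `<=` FF n.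
  move=> kn kN mphi; apply: subset_trans (YF _ _ kn).
  by apply: sigma1_comp_on (mS _ kN) _ mphi => w; exact: SY.
pose V n w := expR (\sum_(0 <= k < n) c (Yh N k w) * h).
have V0 n w : 0 < V n w by exact: expR_gt0.
(* Covers both weights: that of the recursion, with [k] from 0 to [n - 1], and that of the
   remainder, with [k] from 1 to [n]. *)
have weightF a b n : (b <= n.+1)%N -> (n <= N)%N ->
    sigma1 (fun w => expR (\sum_(a <= k < b) c (Yh N k w) * h)) `<=` FF n.
  move=> bn nN; apply/sigma1P.
  apply: (measurableT_comp (@measurable_expR R)).
  rewrite (_ : (fun w => _) = (fun w => \sum_(a <= k < b)
      (if (k <= n)%N then c (Yh N k w) * h else 0))); last first.
    apply/funext => w; apply: eq_big_nat => k /andP[_ kb].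
    by rewrite -ltnS (leq_trans kb bn).
  apply: measurable_sum => k; case: (boolP (k <= n)%N) => kn; last exact: measurable_cst.
  apply: measurable_funM; last exact: measurable_cst.
  have kN := leq_trans kn nN.
  apply/(sigma1P _ (fun w => c (Yh N k w))).
  apply: (comp_FF k n c) => //; apply: (measurable_funS mD _ hcm).
  exact: hYsp.
have VF n : (n <= N)%N -> sigma1 (V n) `<=` FF n.
  by move=> nN; exact: weightF.
pose err n (x : grid X0 dx) w :=
  u (n%:R * h) (val x) (Yh N n w) - uh N dx n x (Yh N n w).
pose rem n x w := Rem N dx n x (Yh N n w).
have errN x w : err N x w = 0.
  rewrite /err Nh huhN//; last exact: SY.
  by have [_ ->] := hpide; [rewrite subrr | exact: YD].
have remF n x : (n < N)%N -> sigma1 (rem n x) `<=` FF n.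
  by move=> nN; apply: (comp_FF n n (Rem N dx n x)) => //; [exact: ltnW | exact: hRemm].
have errF n x : (n <= N)%N -> sigma1 (err n x) `<=` FF n.
  rewrite leq_eqVlt => /predU1P[->|nN].
    rewrite (_ : err N x = cst 0); last by apply/funext => w; rewrite errN.
    by apply/sigma1P; exact: measurable_cst.
  apply: (comp_FF n n (fun y => u (n%:R * h) (val x) y - uh N dx n x y)) => //.
    exact: ltnW.
  have [_ mu _] := hcons N dx n x N0 dx0 nN.
  have [_ muh _] := huh N dx n x N0 dx0 nN.
  apply: measurable_funB => //.
  (* Consistency provides measurability of [u + Rem] only, from which that of [u] follows by
     subtraction. *)
  rewrite [X in measurable_fun _ X](_ : _ = (fun y => (u (n%:R * h) (val x) y + Rem N dx n x y)
      - Rem N dx n x y)); last by apply/funext => y; rewrite addrK.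
  by apply: measurable_funB => //; exact: hRemm.
pose Nrm n := Lnorm (Pr S0) p (fun w => (V n w)%:E * lp_norm p (fun x => err n x w))%E.
have PT : (0 < Pr S0 setT)%E by rewrite probability_setT.
have mV n : (n <= N)%N -> measurable_fun setT (V n).
  by move=> nN; apply: sigma1_measurable (FFm n nN) (VF n nN).
have merr n x : (n <= N)%N -> measurable_fun setT (err n x).
  by move=> nN; apply: sigma1_measurable (FFm n nN) (errF n x nN).
have mrem n x : (n < N)%N -> measurable_fun setT (rem n x).
  by move=> nN; apply: sigma1_measurable (FFm n (ltnW nN)) (remF n x nN).
have rem_le n : (n < N)%N ->
    (Lnorm (Pr S0) p (fun w => (V n w)%:E * lp_norm p (fun x => rem n x w)) <=
     (C * K * h * E h dx)%:E)%E.
  move=> nN.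
  pose W w := expR (\sum_(1 <= k < n.+1) c (Yh N k w) * h).
  have mW : measurable_fun setT W.
    by apply: sigma1_measurable (FFm n (ltnW nN)) _; apply: weightF => //; exact: ltnW.
  have mWlp : measurable_fun setT (fun w => (W w)%:E * lp_norm p (fun x => rem n x w))%E.
    apply: emeasurable_funM; first exact/measurable_EFinP.
    by apply: measurable_lp_norm => // x; exact: mrem.
  have Wlp0 w : (0 <= (W w)%:E * lp_norm p (fun x => rem n x w))%E.
    by rewrite mule_ge0 ?lp_norm_ge0// lee_fin ltW// expR_gt0.
  (* Adding the nonnegative term [k = n] and splitting off [k = 0] turns the first weight into the
     second; the split-off term is [c Y0 * h <= c Y0 * T] since the chain starts at [Y0]. *)
  have VW w : V n w <= K * W w.
    rewrite -expRD ler_expR.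
    apply: (@le_trans _ _ (\sum_(0 <= k < n.+1) c (Yh N k w) * h)).
      by rewrite big_nat_recr//= lerDl mulr_ge0 ?hc0 ?(ltW h0)//; apply: YD; exact: ltnW.
    by rewrite big_ltn// lerD2r hYh0// ler_wpM2l// hc0.
  apply: (@le_trans _ _ (Lnorm (Pr S0) p (fun w =>
      K%:E * ((W w)%:E * lp_norm p (fun x => rem n x w))))%E).
    apply: Lnorm_le_ae => //.
    - apply: emeasurable_funM; first by apply/measurable_EFinP; apply: mV; exact: ltnW.
      by apply: measurable_lp_norm => // x; exact: mrem.
    - exact: measurable_funeM.
    - by move=> w; rewrite mule_ge0 ?lp_norm_ge0// lee_fin ltW.
    - by move=> w; rewrite mule_ge0// lee_fin ltW.
    - apply: nearW => w; rewrite muleA -EFinM; apply: lee_wpmul2r.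
        exact: lp_norm_ge0.
      by rewrite lee_fin.
  rewrite Lnorm_pZl//.
  rewrite (_ : C * K * h * E h dx = K * (C * h * E h dx)); last by ring.
  rewrite EFinM; apply: lee_wpmul2l; first by rewrite lee_fin ltW.
  exact: (hR N dx n).
(* Finiteness of the next norm puts the next error in l_p almost surely, the weight being positive;
   this is what allows linearity and stability to be applied to it. *)
have step n : (n < N)%N -> (Nrm n.+1 < +oo)%E ->
    (Nrm n <= Nrm n.+1 + (C * K * h * E h dx)%:E)%E.
  move=> nN fin.
  pose Psi1 x y y' := Pi N dx y (fun x' => u (n.+1%:R * h) (val x') y') x.
  pose Psi2 x y y' := Pi N dx y (fun x' => uh N dx n.+1 x' y') x.
  pose Z x w := Psi1 x (Yh N n w) (Yh N n.+1 w) - Psi2 x (Yh N n w) (Yh N n.+1 w).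
  apply: le_trans (leeD2l (Nrm n.+1) (rem_le n nN)).
  apply: (@backward_step _ _ _ (Pr S0) _ X0 dx p
    (\bigcup_(i in [set k | (k <= n)%N]) sigma1 (Yh N i))
    (V n) (V n.+1) (err n) (err n.+1) (rem n) Z) => //.
  - exact: FFm (ltnW nN).
  - by apply: VF; exact: ltnW.
  - exact: mV.
  - by move=> x; apply: errF; exact: ltnW.
  - by move=> x; exact: remF.
  - by move=> x; exact: merr.
  - move=> x; have [_ _ [i1 _ _ _]] := hcons N dx n x N0 dx0 nN.
    have [_ _ [i2 _ _ _]] := huh N dx n x N0 dx0 nN.
    by apply: measurable_funB; apply/measurable_EFinP;
      [exact: measurable_int i1 | exact: measurable_int i2].
  - move=> x A FA.
    have := markov_condexp_norm_le chain nN (hcons N dx n x N0 dx0 nN)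
      (huh N dx n x N0 dx0 nN) FA.
    apply: le_trans; rewrite le_eqVlt; apply/orP; left; apply/eqP.
    by apply: eq_integral => w _; rewrite /err /rem addrAC.
  have mVlp : measurable_fun setT (fun w => (V n.+1 w)%:E *
      lp_norm p (fun x => err n.+1 x w))%E.
    apply: emeasurable_funM; first by apply/measurable_EFinP; exact: mV.
    by apply: measurable_lp_norm => // x; exact: merr.
  have := Lnorm_lty_ae hp PT mVlp fin.
  apply: filterS => w Vfin.
  have errfin : in_lp p (fun x => err n.+1 x w).
    rewrite /in_lp ltey; apply/eqP => ey; move: Vfin.
    by rewrite ey gt0_muley ?lte_fin// ltxx.
  have Dn : D (Yh N n w) by apply: YD; exact: ltnW.
  have chn : 0 <= c (Yh N n w) * h by rewrite mulr_ge0 ?hc0// ltW.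
  have -> : (fun x => Z x w) = Pi N dx (Yh N n w) (fun x => err n.+1 x w).
    apply/funext => x; rewrite /Z /Psi1 /Psi2 /err.
    rewrite (lp_operatorB x (hPi N dx _ N0 dx0 Dn))//.
    by apply: hul => //; exact: SY.
  have := lp_opnorm_le dx0 hp _ (hPi N dx _ N0 dx0 Dn) (hstab N dx _ N0 dx0 Dn) errfin.
  rewrite -/h => /(_ (addr_ge0 ler01 chn)) Zle.
  apply: (@le_trans _ _ ((V n w)%:E * ((1 + c (Yh N n w) * h)%:E *
      lp_norm p (fun x => err n.+1 x w)))%E).
    by rewrite lee_pmul2l ?lte_fin.
  rewrite muleA -EFinM; apply: lee_wpmul2r; first exact: lp_norm_ge0.
  (* The new factor of [V n.+1] is [exp (c h)], which dominates the stability constant [1 + c h]. *)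
  rewrite lee_fin {2}/V big_nat_recr//= expRD ler_pM2l//.
  exact: expR_ge1Dx.
(* Backward induction, [k] counting the steps from the terminal time. The bound is a real number and
   so supplies the finiteness that the next step requires. *)
have main k : (k <= N)%N -> (Nrm (N - k)%N <= (k%:R * (C * K * h * E h dx))%:E)%E.
  elim: k => [_|k IH kN].
    rewrite subn0 mul0r /Nrm (_ : (fun w => _) = cst 0%E) ?Lnorm_prob_cst//.
    apply/funext => w; rewrite (_ : (fun x => _) = (fun=> 0)); last first.
      by apply/funext => x; rewrite errN.
    by rewrite lp_norm0// mule0.
  have nN : (N - k.+1 < N)%N by rewrite ltn_subrL.
  have nE : ((N - k.+1).+1 = N - k)%N by rewrite subnSK.
  have IHk := IH (ltnW kN).
  have := step _ nN; rewrite nE => /(_ (le_lt_trans IHk (ltry _))).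
  move=> /le_trans; apply; apply: (le_trans (leeD IHk (lexx _))).
  by rewrite -EFinD lee_fin -natr1 mulrDl mul1r.
have := main N (leqnn N).
rewrite subnn (_ : N%:R * (C * K * h * E h dx) = C * K * T * E h dx); last first.
  by rewrite -Nh; ring.
apply: le_trans.
(* At step 0 the weight is 1 and the chain sits at [Y0], so [Nrm 0] is the norm of a constant on a
   probability space. *)
rewrite /Nrm (_ : (fun w => _) = cst (lp_norm p (fun x : grid X0 dx =>
    (u 0 (val x) Y0 - uh N dx 0%N x Y0)%R))); last first.
  apply/funext => w; rewrite /V big_geq// expR0 mul1e /err mul0r.
  by rewrite hYh0.
by rewrite Lnorm_prob_cst// lp_norm_ge0.
Qed.
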